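(* Let $X_1,\ldots,X_n$ be symmetric i.i.d. real random variables having a density $\phi$ with integrable and positive Fourier transform $\hat\phi$. Let $p\in(-1,2]$, $p\ne0$, assume that the second moment and the $p$-th absolute moment of $X_1$ are finite, and let $Z$ be a centered Gaussian random variable with $\mathrm{Var}(Z)=\mathrm{Var}(X_1)$. Then for each $\theta\in S^{n-1}$: (i) if $t\mapsto\hat\phi(\sqrt t)$ is log-concave on $(0,+\infty)$, $$\frac{\|Z\|_p}{\|X_1\|_2}\left\|\sum_{i=1}^n\theta_iX_i\right\|_2\le\left\|\sum_{i=1}^n\theta_iX_i\right\|_p\le\frac{\|X_1\|_p}{\|X_1\|_2}\left\|\sum_{i=1}^n\theta_iX_i\right\|_2;$$ (ii) if $t\mapsto\hat\phi(\sqrt t)$ is log-convex on $(0,+\infty)$, $$\frac{\|Z\|_p}{\|X_1\|_2}\left\|\sum_{i=1}^n\theta_iX_i\right\|_2\ge\left\|\sum_{i=1}^n\theta_iX_i\right\|_p\ge\frac{\|X_1\|_p}{\|X_1\|_2}\left\|\sum_{i=1}^n\theta_iX_i\right\|_2.$$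
   Context: For a real random variable $W$ and $p\neq0$, $\|W\|_p=(\mathbb{E}|W|^p)^{1/p}$. $S^{n-1}$ is the Euclidean unit sphere of $\mathbb{R}^n$. Fourier transform convention: $\hat f(x)=\int_{\mathbb{R}}f(y)e^{-2\pi ixy}dy$; ''positive'' means $\ge0$. A function $f:C\to[0,\infty)$ on a convex set $C$ is log-convex (resp. log-concave) if $f(\lambda x+(1-\lambda)y)\le f(x)^\lambda f(y)^{1-\lambda}$ (resp. $\ge$) for all $x,y\in C$, $\lambda\in(0,1)$. *)

(* Defs.v *)
From HB Require Import structures.
From mathcomp Require Export all_boot all_order all_algebra.
From mathcomp Require Export complex.
From mathcomp Require Export all_classical all_reals all_analysis.

Set Implicit Arguments.
Unset Strict Implicit.
Unset Printing Implicit Defensive.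

Import Order.TTheory GRing.Theory Num.Theory.
Import numFieldNormedType.Exports.

Local Open Scope classical_set_scope.
Local Open Scope ring_scope.
Local Open Scope complex_scope.

(* The power x ^ r of x in [0, +oo] for a nonzero real r, with 0 ^ r = +oo and
   (+oo) ^ r = 0 when r < 0.  The library's poweR, hence its Lnorm, follows
   another convention for negative exponents: there 0 ^ r = 0 and
   (+oo) ^ r = +oo. *)
Definition epow (R : realType) (x : \bar R) (r : R) : \bar R :=
  if r < 0 then (poweR x (- r))^-1%E else poweR x r.

Definition abs_moment (R : realType) (d : measure_display)
    (T : measurableType d) (P : probability T R) (W : T -> R) (p : R) : \bar R :=
  (\int[P]_w epow `|W w|%:E p)%E.

Definition pnorm (R : realType) (d : measure_display)
    (T : measurableType d) (P : probability T R) (W : T -> R) (p : R) : \bar R :=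
  epow (abs_moment P W p) p^-1.

Definition same_law (R : realType) (d d' : measure_display)
    (T : measurableType d) (T' : measurableType d')
    (P : probability T R) (Q : probability T' R)
    (X : T -> R) (Y : T' -> R) : Prop :=
  forall A : set R, measurable A -> P (X @^-1` A) = Q (Y @^-1` A).

Definition symmetric_rv (R : realType) (d : measure_display)
    (T : measurableType d) (P : probability T R) (X : T -> R) : Prop :=
  same_law P P X (fun w => - X w).

Definition mutually_independent (R : realType) (d : measure_display)
    (T : measurableType d) (P : probability T R) (I : finType)
    (X : I -> T -> R) : Prop :=
  forall (J : {set I}) (A : I -> set R), (forall i, measurable (A i)) ->
    P [set w | forall i, i \in J -> A i (X i w)]
    = (\prod_(i in J) P (X i @^-1` A i))%E.

Definition iid (R : realType) (d : measure_display)
    (T : measurableType d) (P : probability T R) (I : finType)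
    (X : I -> T -> R) : Prop :=
  mutually_independent P X /\ forall i j, same_law P P (X i) (X j).

Definition has_density (R : realType) (d : measure_display)
    (T : measurableType d) (P : probability T R)
    (X : T -> R) (phi : R -> R) : Prop :=
  [/\ measurable_fun setT phi, (forall x, 0 <= phi x)
    & forall A : set R, measurable A ->
        P (X @^-1` A) = (\int[lebesgue_measure]_(x in A) (phi x)%:E)%E].

(* normal_prob is parametrized by mean and standard deviation; its value at
   standard deviation 0 is not a Gaussian law. *)
Definition centered_gaussian (R : realType) (d : measure_display)
    (T : measurableType d) (Q : probability T R) (Z : T -> R) : Prop :=
  exists2 s : R, 0 < s &
    forall A : set R, measurable A -> Q (Z @^-1` A) = normal_prob 0 s A.

Definition expi (R : realType) (t : R) : R[i] := cos t +i* sin t.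

Definition cintegral (R : realType) (f : R -> R[i]) : R[i] :=
  (\int[lebesgue_measure]_y complex.Re (f y))
  +i* (\int[lebesgue_measure]_y complex.Im (f y)).

Definition cintegrable (R : realType) (f : R -> R[i]) : Prop :=
  lebesgue_measure.-integrable setT (fun x => (complex.Re (f x))%:E) /\
  lebesgue_measure.-integrable setT (fun x => (complex.Im (f x))%:E).

Definition fourier (R : realType) (f : R -> R) (x : R) : R[i] :=
  cintegral (fun y => (f y)%:C * expi (- (2 * pi * x * y))).

Definition log_concave_on (R : realType) (C : set R) (f : R -> R) : Prop :=
  forall x y l : R, C x -> C y -> 0 < l < 1 ->
    f x `^ l * f y `^ (1 - l) <= f (l * x + (1 - l) * y).

Definition log_convex_on (R : realType) (C : set R) (f : R -> R) : Prop :=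
  forall x y l : R, C x -> C y -> 0 < l < 1 ->
    f (l * x + (1 - l) * y) <= f x `^ l * f y `^ (1 - l).

(* The norm of the library on 'rV is the sup norm. *)
Definition euclidean_sphere (R : realType) (n : nat) : set 'rV[R]_n :=
  [set theta | Num.sqrt (\sum_(i < n) theta ord0 i ^+ 2) = 1].

(* Main.v *)
Require Import Defs.
From mathcomp Require Import measurable_realfun.
From mathcomp Require Import ring lra.

Set Implicit Arguments.
Unset Strict Implicit.
Unset Printing Implicit Defensive.

Import Order.TTheory GRing.Theory Num.Theory.
Import numFieldNormedType.Exports.

Local Open Scope classical_set_scope.
Local Open Scope ring_scope.

(** Write psi for the characteristic function of X_1, which is real because X_1
    is symmetric; it is the Fourier transform of phi after a rescaling by
    2 * pi. Put g(t) = psi (sqrt t), so that g 0 = 1, and let v = E X_1^2.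

    Suppose that g is log-concave. Comparing t with 0 gives
    psi(t)^(c^2) <= psi(c t) whenever c^2 <= 1. By independence the
    characteristic function of S is the product of the psi(theta_i t), so it is
    at least the product of the psi(t)^(theta_i^2), that is, psi(t)
    ([log_concave_powR_le], [chf_sum_independent]). With c = 1 / n the same
    inequality reads psi(t) <= psi(t / n)^(n^2), and letting n grow gives
    psi(t) <= exp(- v t^2 / 2) ([chf_le_gaussian]); multiplying over i, the
    characteristic function of S is at most that of Z. Hence
    psi <= chf S <= chf Z pointwise; in the log-convex case both inequalities
    are reversed.

    It remains to see that a larger characteristic function means a smaller
    p-norm ([le_pnorm_chf]). For 0 < p < 2 and for p < 0, |w|^p is, up to a
    positive constant, the integral of K (e^u w) e^(- p u) over all real u, where
    the kernel K is 1 - cos when p > 0 and x |-> exp (- x^2 / 2) when p < 0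
    ([mellin_scale]). By Tonelli, E |W|^p is the same mixture of the quantities
    E K (t W). For the first kernel, E K (t W) = 1 - chf W t. For the second,
    exp (- x^2 / 2) is the average of cos (x y) over a standard Gaussian y
    ([gaussian_cos]), so E K (t W) is the Gaussian average of chf W (t y). For
    p = 2, E W^2 / 2 is the limit of n^2 (1 - chf W (1 / n)) by Fatou's lemma and
    the inequality 1 - cos x <= x^2 / 2.

    The case p = 2 of the comparison, together with E Z^2 = E X_1^2, shows that S
    has second moment v as well, so the quotients of 2-norms in the statement
    are equal to 1. *)

(** * Laws and weighted laws *)

Section measurability.
Context {R : realType} d (T : measurableType d).
Implicit Types W : T -> R.

Lemma measurable_preimageT W (A : set R) :
  measurable_fun setT W -> measurable A -> measurable (W @^-1` A).
Proof. by move=> mW mA; rewrite -[X in measurable X]setTI; exact: mW. Qed.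

Lemma measurable_cosM W (t : R) : measurable_fun setT W ->
  measurable_fun setT (fun w => cos (t * W w)).
Proof.
move=> mW; apply: (measurableT_comp (continuous_measurable_fun (@continuous_cos R))).
exact: measurable_funM.
Qed.

Lemma measurable_sinM W (t : R) : measurable_fun setT W ->
  measurable_fun setT (fun w => sin (t * W w)).
Proof.
move=> mW; apply: (measurableT_comp (continuous_measurable_fun (@continuous_sin R))).
exact: measurable_funM.
Qed.

End measurability.

Lemma integral_probability_cst1 {R : realType} d (T : measurableType d)
  (P : probability T R) : (\int[P]_w (1 : R)%:E = 1)%E.
Proof. by rewrite integral_cst// mul1e; exact: probability_setT. Qed.

Section weighted_law.
Context {R : realType} d (T : measurableType d) (m : {measure set T -> \bar R}).
Variables (X G : T -> R).
Hypothesis mX : measurable_fun setT X.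
Hypothesis mG : measurable_fun setT G.
Hypothesis G0 : forall x, 0 <= G x.
Import HBNNSimple.

Let integral_weighted_nnsfun (f : {nnsfun R >-> R}) :
  (\int[m]_x (f (X x) * G x)%:E =
   \sum_(k \in range f) k%:E * \int[m]_(x in X @^-1` (f @^-1` [set k])) (G x)%:E)%E.
Proof.
have mk k : measurable (X @^-1` (f @^-1` [set k])) by exact: measurable_preimageT.
have k0 k x : 0 <= k * \1_(X @^-1` (f @^-1` [set k])) x.
  have := nnfun_muleindic_ge0 f k (X x).
  by rewrite -EFinM lee_fin.
have mkf k : measurable_fun setT
    (fun x => k * \1_(X @^-1` (f @^-1` [set k])) x * G x).
  by apply: measurable_funM => //; exact: measurable_funM.
transitivity (\sum_(k \in range f) \int[m]_x
   (k * \1_(X @^-1` (f @^-1` [set k])) x * G x)%:E)%E.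
  rewrite -ge0_integral_fsum//=.
  - apply: eq_integral => x _.
    rewrite fimfunE EFinM -fsumEFin// ge0_mule_fsuml; last first.
      by move=> k; exact: (k0 k x).
    by apply: eq_fsbigr => k _; rewrite -EFinM.
  - by move=> k; exact/measurable_EFinP.
  - by move=> k x _; rewrite lee_fin mulr_ge0.
apply: eq_fsbigr => _ /[!inE] -[y _ <-].
rewrite -ge0_integralZl//=.
- rewrite [RHS]integral_mkcond; apply: eq_integral => x _; rewrite patchE indicE.
  by case: ifP => _; rewrite ?mulr1 ?mulr0 ?mul0r ?EFinM//.
- by apply: measurable_funTS; exact/measurable_EFinP.
- by move=> x _; rewrite lee_fin.
- by rewrite lee_fin.
Qed.

(** The right-hand side depends on X, G and m only through the measures of the
    preimages X @^-1` A weighted by G. *)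
Lemma integral_weighted (f : R -> R) (mf : measurable_fun setT (EFin \o f))
    (f0 : forall x, 0 <= f x) :
  (\int[m]_x (f (X x) * G x)%:E =
   limn (fun n => let fn := nnsfun_approx measurableT mf n in
     \sum_(k \in range fn)
       k%:E * \int[m]_(x in X @^-1` (fn @^-1` [set k])) (G x)%:E))%E.
Proof.
pose fn := nnsfun_approx measurableT mf.
transitivity (limn (fun n => \int[m]_x (fn n (X x) * G x)%:E))%E; last first.
  by congr (limn _); apply/funext => n; rewrite integral_weighted_nnsfun.
rewrite -monotone_convergence//=.
- apply: eq_integral => x _; apply/esym/cvg_lim => //=.
  under eq_fun do rewrite EFinM.
  rewrite EFinM; apply: cvgeZr => //.
  by apply: (cvg_nnsfun_approx measurableT mf) => // y _; rewrite lee_fin.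
- move=> n; apply/measurable_EFinP/measurable_funM => //.
  exact: measurableT_comp.
- by move=> n x _; rewrite lee_fin mulr_ge0.
- move=> x _ a b ab; rewrite lee_fin ler_wpM2r//.
  exact/lefP/nd_nnsfun_approx.
Qed.

End weighted_law.

Section eq_weighted.
Import HBNNSimple.

(** If the image under X1 of the measure with density G1 agrees on Borel sets
    with the image under X2 of the measure with density G2, the two integrate
    every nonnegative Borel function equally. Densities, equality in law and
    independence are all used through this lemma. *)
Lemma eq_weighted_integral {R : realType} d1 d2 (T1 : measurableType d1)
    (T2 : measurableType d2) (m1 : {measure set T1 -> \bar R})
    (m2 : {measure set T2 -> \bar R}) (X1 G1 : T1 -> R) (X2 G2 : T2 -> R) (f : R -> R) :
  measurable_fun setT X1 -> measurable_fun setT G1 -> (forall x, 0 <= G1 x) ->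
  measurable_fun setT X2 -> measurable_fun setT G2 -> (forall x, 0 <= G2 x) ->
  (forall A : set R, measurable A ->
    \int[m1]_(x in X1 @^-1` A) (G1 x)%:E = \int[m2]_(x in X2 @^-1` A) (G2 x)%:E)%E ->
  measurable_fun setT f -> (forall x, 0 <= f x) ->
  (\int[m1]_x (f (X1 x) * G1 x)%:E = \int[m2]_x (f (X2 x) * G2 x)%:E)%E.
Proof.
move=> mX1 mG1 G10 mX2 mG2 G20 eqA mf f0.
have mf' : measurable_fun setT (EFin \o f) by exact/measurable_EFinP.
rewrite (integral_weighted _ mX1 mG1 G10 mf')//.
rewrite (integral_weighted _ mX2 mG2 G20 mf')//.
by congr (limn _); apply/funext => n /=; apply: eq_fsbigr => k _; rewrite eqA.
Qed.

End eq_weighted.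

Section bounded_weights.
Context {R : realType} d (T : measurableType d).
Implicit Types (P : probability T R).

Lemma integrable_bounded P (f : T -> R) (M : R) :
  measurable_fun setT f -> (forall x, `|f x| <= M) ->
  P.-integrable setT (EFin \o f).
Proof.
move=> mf fM; apply: (@le_integrable _ _ _ P _ measurableT _ (fun=> M%:E)).
- exact/measurable_EFinP.
- by move=> x _; rewrite lee_fin (le_trans (fM x))// ler_norm.
- exact: finite_measure_integrable_cst.
Qed.

End bounded_weights.

(** Signed version of [eq_weighted_integral], obtained by adding 1 to f. *)
Lemma eq_weighted_Rintegral {R : realType} d1 d2 (T1 : measurableType d1)
    (T2 : measurableType d2) (m1 : {measure set T1 -> \bar R})
    (m2 : {measure set T2 -> \bar R}) (X1 G1 : T1 -> R) (X2 G2 : T2 -> R) (f : R -> R) :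
  measurable_fun setT X1 -> (forall x, 0 <= G1 x) -> m1.-integrable setT (EFin \o G1) ->
  measurable_fun setT X2 -> (forall x, 0 <= G2 x) -> m2.-integrable setT (EFin \o G2) ->
  (forall A : set R, measurable A ->
    \int[m1]_(x in X1 @^-1` A) (G1 x)%:E = \int[m2]_(x in X2 @^-1` A) (G2 x)%:E)%E ->
  measurable_fun setT f -> (forall x, `|f x| <= 1) ->
  \int[m1]_x (f (X1 x) * G1 x) = \int[m2]_x (f (X2 x) * G2 x).
Proof.
move=> mX1 G10 iG1 mX2 G20 iG2 eqA mf f1.
have mG1 : measurable_fun setT G1 by apply/measurable_EFinP/(measurable_int m1).
have mG2 : measurable_fun setT G2 by apply/measurable_EFinP/(measurable_int m2).
have ifG d (T : measurableType d) (m : {measure set T -> \bar R}) (X G : T -> R) :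
    measurable_fun setT X -> (forall x, 0 <= G x) -> m.-integrable setT (EFin \o G) ->
    m.-integrable setT (EFin \o (fun x => f (X x) * G x)).
  move=> mX G0 iG; apply: (le_integrable measurableT _ _ iG).
  - apply/measurable_EFinP/measurable_funM; first exact: measurableT_comp.
    by apply/measurable_EFinP/(measurable_int m).
  - by move=> x _ /=; rewrite lee_fin normrM ler_piMl.
have E0 : \int[m1]_x G1 x = \int[m2]_x G2 x.
  by rewrite /Rintegral; congr fine; have := eqA setT measurableT; rewrite !preimage_setT.
have : (\int[m1]_x ((f (X1 x) + 1) * G1 x)%:E = \int[m2]_x ((f (X2 x) + 1) * G2 x)%:E)%E.
  apply: (eq_weighted_integral (f := fun x => f x + 1)) => //.
    exact: measurable_funD.
  by move=> x; have := f1 x; rewrite ler_norml => /andP[? _]; lra.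
move/(congr1 fine); rewrite -!/(Rintegral _ _ _).
under eq_Rintegral do rewrite mulrDl mul1r.
under [in RHS]eq_Rintegral do rewrite mulrDl mul1r.
rewrite !RintegralD ?E0//; [|exact: ifG..].
exact: addIr.
Qed.

Section signed_weight.
Context {R : realType} d (T : measurableType d) (P : probability T R).

(** A bounded weight G that is uncorrelated with every event of X, c being
    necessarily its mean, is uncorrelated with every bounded function of X. *)
Lemma Rintegral_uncorrelated (X G : T -> R) (c : R) (f : R -> R) :
  measurable_fun setT X -> measurable_fun setT G -> (forall x, `|G x| <= 1) ->
  (forall A : set R, measurable A ->
    \int[P]_(x in X @^-1` A) G x = c * fine (P (X @^-1` A))) ->
  measurable_fun setT f -> (forall x, `|f x| <= 1) ->
  \int[P]_x (f (X x) * G x) = c * \int[P]_x f (X x).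
Proof.
move=> mX mG G1 eqA mf f1.
have iG := integrable_bounded P mG G1.
have i1 : P.-integrable setT (EFin \o (fun=> 1 : R)).
  exact: finite_measure_integrable_cst.
have iff : P.-integrable setT (EFin \o (fun x => f (X x))).
  by apply: (@integrable_bounded _ _ _ _ _ 1) => //; exact: measurableT_comp.
have iffG : P.-integrable setT (EFin \o (fun x => f (X x) * G x)).
  apply: (@integrable_bounded _ _ _ _ _ 1).
    by apply: measurable_funM => //; exact: measurableT_comp.
  by move=> x; rewrite normrM mulr_ile1.
have cE : c = \int[P]_x G x.
  have := eqA setT measurableT; rewrite !preimage_setT probability_setT/= mulr1.
  by move=> ->.
have c1 : 0 <= c + 1.
  rewrite -lerBlDr sub0r cE.
  have -> : -1 = \int[P]_x (-1 : R).
    by rewrite Rintegral_cst// [X in fine X](_ : _ = 1%E) ?mulr1//; exact: probability_setT.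
  apply: le_Rintegral => //.
    exact: finite_measure_integrable_cst.
  by move=> x _; have := G1 x; rewrite ler_norml => /andP[].
have : \int[P]_x (f (X x) * (G x + 1)) = \int[P]_x (f (X x) * (c + 1)).
  apply: eq_weighted_Rintegral => //.
  - by move=> x; have := G1 x; rewrite ler_norml => /andP[? _]; lra.
  - by rewrite /comp; under eq_fun do rewrite EFinD; exact: integrableD.
  - exact: finite_measure_integrable_cst.
  - move=> A mA.
    have mXA : measurable (X @^-1` A).
      exact: measurable_preimageT.
    have iS g : P.-integrable setT g -> P.-integrable (X @^-1` A) g.
      by apply: integrableS.
    rewrite integral_cst//.
    under eq_integral do rewrite EFinD.
    rewrite integralD//; [|exact: iS..].
    rewrite integral_cst// mul1e EFinD muleDl//; last first.
      exact: fin_num_measure.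
    rewrite [in RHS]mul1e; congr (_ + _)%E.
    rewrite -[LHS]fineK ?integrable_fin_num//; last exact: iS.
    by rewrite -/(Rintegral _ _ _) eqA// EFinM fineK// fin_num_measure.
under eq_Rintegral do rewrite mulrDr mulr1.
rewrite RintegralD// RintegralZr// mulrDr mulr1 mulrC.
exact: addIr.
Qed.

End signed_weight.

(** * Characteristic functions and independent sums *)

Section chf.
Context {R : realType} d (T : measurableType d) (P : probability T R).

(** The real part of the characteristic function of W, which is the whole
    characteristic function when W is symmetric. *)
Definition chf (W : T -> R) (t : R) : R := \int[P]_w cos (t * W w).

Lemma integrable_cosM (W : T -> R) (t : R) : measurable_fun setT W ->
  P.-integrable setT (EFin \o (fun w => cos (t * W w))).
Proof.
move=> mW; apply: (@integrable_bounded _ _ _ _ _ 1); first exact: measurable_cosM.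
by move=> x; exact: cos_max.
Qed.

Lemma Rintegral_sin_sym (W : T -> R) (t : R) : measurable_fun setT W ->
  symmetric_rv P W -> \int[P]_w sin (t * W w) = 0.
Proof.
move=> mW symW.
have : \int[P]_w (sin (t * W w) * 1) = \int[P]_w (sin (t * - W w) * 1).
  apply: (eq_weighted_Rintegral (X2 := fun w => - W w)
    (f := fun x => sin (t * x))) => //.
  - exact: finite_measure_integrable_cst.
  - exact: measurableT_comp.
  - exact: finite_measure_integrable_cst.
  - move=> A mA; rewrite !integral_cst//.
    + by rewrite !mul1e; exact: symW.
    + by apply: measurable_preimageT => //; exact: measurableT_comp.
    + exact: measurable_preimageT.
  - exact: measurable_sinM.
  - by move=> x; exact: sin_max.
under eq_Rintegral do rewrite mulr1.
under [in RHS]eq_Rintegral do rewrite mulr1 mulrN sinN -mulN1r.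
rewrite RintegralZl//; first by rewrite mulN1r => ?; lra.
apply: (@integrable_bounded _ _ _ _ _ 1); last by move=> x; exact: sin_max.
exact: measurable_sinM.
Qed.

Section independent_sum.
Context (I : finType) (X : I -> T -> R) (a : I -> R).
Hypothesis mX : forall i, measurable_fun setT (X i).
Hypothesis indepX : mutually_independent P X.
Hypothesis symX : forall i, symmetric_rv P (X i).

(* The event that X i lies in A i for every i in J. *)
Let E (J : {set I}) (A : I -> set R) := [set w | forall i, i \in J -> A i (X i w)].

Let mE J A : (forall i, measurable (A i)) -> measurable (E J A).
Proof.
move=> mA.
have -> : E J A = \bigcap_(i in [set` J]) (X i @^-1` A i).
  by apply/seteqP; split => w.
apply: fin_bigcap_measurable => // i _.
exact: measurable_preimageT.
Qed.

(* The partial sum over s is decoupled from the events of the variables outside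
   s; keeping these events and the phase b in the statement makes the induction
   on s go through. *)
Let Rintegral_cos_sum (s : seq I) : uniq s -> forall (J : {set I}) A b,
  (forall i, measurable (A i)) -> (forall i, i \in s -> i \notin J) ->
  \int[P]_(w in E J A) cos (\sum_(i <- s) a i * X i w + b) =
  cos b * \prod_(i <- s) chf (X i) (a i) * \prod_(i in J) fine (P (X i @^-1` A i)).
Proof.
elim: s => [_|j s IHs /= /andP[js us]] J A b mA sJ.
  under eq_Rintegral do rewrite big_nil add0r.
  rewrite Rintegral_cst; last exact: mE.
  rewrite big_nil mulr1; congr (_ * _).
  transitivity (fine (\prod_(i in J) P (X i @^-1` A i))%E).
    by congr fine; exact: indepX.
  suff -> : (\prod_(i in J) P (X i @^-1` A i) =
      (\prod_(i in J) fine (P (X i @^-1` A i)))%:E)%E by [].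
  rewrite -prodEFin; apply: eq_bigr => i _; rewrite fineK//; apply: fin_num_measure.
  exact: measurable_preimageT.
pose G b := (fun w => cos (\sum_(i <- s) a i * X i w + b)) \_ (E J A).
pose c b := cos b * \prod_(i <- s) chf (X i) (a i) *
              \prod_(i in J) fine (P (X i @^-1` A i)).
have mU b' : measurable_fun setT (fun w => cos (\sum_(i <- s) a i * X i w + b')).
  apply: measurableT_comp; first exact: (continuous_measurable_fun (@continuous_cos R)).
  apply: measurable_funD => //; apply: measurable_sum => i.
  exact: measurable_funM.
have mG b' : measurable_fun setT (G b').
  apply/(measurable_restrictT _ _).1; first exact: mE.
  exact: measurable_funTS.
have G1 b' x : `|G b' x| <= 1.
  by rewrite /G patchE; case: ifP => _; rewrite ?cos_max ?normr0.
have GA b' (B : set R) : measurable B ->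
    \int[P]_(x in X j @^-1` B) G b' x = c b' * fine (P (X j @^-1` B)).
  move=> mB; rewrite -Rintegral_mkcondr.
  pose A' i := if i == j then B else A i.
  have -> : X j @^-1` B `&` E J A = E (j |: J) A'.
    apply/seteqP; split => [w [Bw Ew] i|w Ew].
      rewrite in_setU1 /A' => /predU1P[->|iJ]; first by rewrite eqxx.
      case: eqP => [ij|_]; last exact: Ew.
      by have := sJ j (mem_head _ _); rewrite -ij iJ.
    split; first by have := Ew j (setU11 _ _); rewrite /A' eqxx.
    move=> i iJ; have := Ew i (setU1r _ iJ); rewrite /A'.
    case: eqP => [ij|//]; by have := sJ j (mem_head _ _); rewrite -ij iJ.
  rewrite IHs//; last 2 first.
  - by move=> i; rewrite /A'; case: ifP.
  - move=> i si; rewrite in_setU1 negb_or sJ ?inE ?si ?orbT// andbT.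
    by apply: contraNneq js => <-.
  rewrite big_setU1/=; last exact: (sJ j (mem_head _ _)).
  rewrite /c -!mulrA; congr (_ * (_ * _)).
  rewrite mulrC /A' eqxx; congr (_ * _).
  apply: eq_bigr => i iJ; case: eqP => // ij.
  by have := sJ j (mem_head _ _); rewrite -ij iJ.
rewrite Rintegral_mkcond.
(* cos (x + y) = cos x cos y - sin x sin y, where sin y = cos (y - pi / 2) has
   the form covered by the induction hypothesis; the sine of a j * X j has mean
   zero by symmetry. *)
transitivity (\int[P]_w (cos (a j * X j w) * G b w - sin (a j * X j w) * G (b - pi / 2) w)).
  apply: eq_Rintegral => w _; rewrite /G !patchE.
  case: ifP => _; last by rewrite !mulr0 subr0.
  by rewrite big_cons -addrA cosD addrA cosBpihalf.
have msin : measurable_fun setT (fun x : R => sin (a j * x)) by exact: measurable_sinM.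
have mcos : measurable_fun setT (fun x : R => cos (a j * x)) by exact: measurable_cosM.
rewrite RintegralB//; last 2 first.
- apply: (@integrable_bounded _ _ _ _ _ 1).
    apply: measurable_funM => //; exact: (measurableT_comp mcos).
  by move=> x; rewrite normrM mulr_ile1// ?cos_max ?G1.
- apply: (@integrable_bounded _ _ _ _ _ 1).
    apply: measurable_funM => //; exact: (measurableT_comp msin).
  by move=> x; rewrite normrM mulr_ile1// ?sin_max ?G1.
rewrite (@Rintegral_uncorrelated _ _ _ P (X j) (G b) (c b) (fun x => cos (a j * x)))//;
  [|exact: GA|by move=> x; exact: cos_max].
rewrite (@Rintegral_uncorrelated _ _ _ P (X j) (G (b - pi / 2)) (c (b - pi / 2))
  (fun x => sin (a j * x)))//; [|exact: GA|by move=> x; exact: sin_max].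
rewrite Rintegral_sin_sym// mulr0 subr0 big_cons /c -/(chf _ _).
by rewrite mulrAC mulrA (mulrAC (cos b)) -!mulrA.
Qed.

Lemma chf_sum_independent :
  chf (fun w => \sum_i a i * X i w) 1 = \prod_i chf (X i) (a i).
Proof.
have := Rintegral_cos_sum (index_enum_uniq I) (J := finset.set0) (A := fun=> setT) 0.
have -> : E finset.set0 (fun=> setT) = setT by apply/seteqP; split => w // _ i.
rewrite big_set0 cos0 mul1r mulr1 => <-//; last by move=> i; rewrite inE.
by rewrite /chf; apply: eq_Rintegral => w _; rewrite mul1r addr0.
Qed.

End independent_sum.
End chf.

(** * Calculus on the real line *)

Section calculus.
Context {R : realType}.
Local Notation mu := (@lebesgue_measure R).

Lemma integrable_expR_Nabs (c : R) : 0 < c ->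
  mu.-integrable setT (EFin \o (fun u : R => expR (- (c * `|u|)))).
Proof.
move=> c0.
have cf : continuous (fun u : R => expR (- (c * `|u|))).
  move=> u; apply: continuous_comp; last exact: continuous_expR.
  apply: continuousN; apply: continuousM; first exact: cvg_cst.
  exact: norm_continuous.
apply/integrableP; split.
  by apply/measurable_EFinP; exact: continuous_measurable_fun.
under eq_integral do rewrite /= ger0_norm ?expR_ge0//.
rewrite ge0_symfun_integralT//; last by move=> x /=; rewrite normrN.
apply: lte_mul_pinfty => //.
have -> : (\int[mu]_(x in [set x | (0 <= x)%R]) (expR (- (c * `|x|)))%:E =
    \int[mu]_(x in [set x | (0 <= x)%R]) (expR (- (c * x)))%:E)%E.
  by apply: eq_integral => u; rewrite inE/= => u0; rewrite ger0_norm.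
have -> : [set x : R | 0 <= x] = `[0, +oo[%classic.
  by apply/seteqP; split => x; rewrite /= in_itv/= andbT.
rewrite (@ge0_continuous_FTC2y _ _ (fun u => - expR (- (c * u)) / c) _ 0).
- by rewrite ltey.
- by move=> x _; exact: expR_ge0.
- apply: continuous_subspaceT => u; apply: continuous_comp; last exact: continuous_expR.
  by apply: continuousN; apply: continuousM; [exact: cvg_cst|exact: cvg_id].
- rewrite -[X in _ --> X](mul0r c^-1); apply: cvgM; last exact: cvg_cst.
  rewrite -oppr0; apply: cvgN.
  apply: (@cvg_comp _ _ _ (fun x => c * x) (fun x => expR (- x)) _ +oo%R).
    by apply: gt0_cvgMry => //; exact: cvg_id.
  exact: cvgr_expR.
- by move=> x _; apply: ex_derive.
- apply: cvg_at_right_filter.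
  apply: cvgM; last exact: cvg_cst.
  apply: cvgN; apply: continuous_comp; last exact: continuous_expR.
  by apply: continuousN; apply: continuousM; [exact: cvg_cst|exact: cvg_id].
- move=> x _; rewrite derive1E; apply: derive_val; apply: trigger_derive.
  rewrite /GRing.scale/= !mulr1 mulr0 add0r; field; exact: lt0r_neq0.
Qed.


Lemma integral_derive0 (H h : R -> R) :
  (forall x : R, is_derive x (1 : R) H (h x)) -> continuous h ->
  mu.-integrable setT (EFin \o h) ->
  H n%:R @[n --> \oo] --> 0 -> H (- n%:R) @[n --> \oo] --> 0 ->
  \int[mu]_x h x = 0.
Proof.
move=> dH ch ih Hy HNy.
pose I n : set R := `[- n.+1%:R, n.+1%:R]%classic.
have mh : measurable_fun setT (EFin \o h) by exact: (measurable_int mu).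
have lim1 : (\int[mu]_(x in I n) (h x)%:E)%E @[n --> \oo] --> (\int[mu]_x (h x)%:E)%E.
  under eq_fun do rewrite integral_mkcond.
  apply: (@dominated_cvg _ _ _ mu setT measurableT
    (fun n => (fun x => (h x)%:E) \_ (I n)) _ (fun x => `|h x|%:E)) => //.
  - move=> n; apply/(measurable_restrictT _ _).1; first exact: measurable_itv.
    exact: measurable_funTS.
  - move=> x _; apply: cvg_near_cst.
    exists (Num.bound `|x|) => // n /= xn.
    rewrite patchE mem_set// /I/= in_itv/= -ler_norml.
    rewrite (le_trans (ltW (archi_boundP (normr_ge0 x))))// ler_nat.
    exact: leq_trans xn (leqnSn _).
  - exact: integrable_norm.
  - move=> n x _; rewrite patchE; case: ifP => _ //=.
    by rewrite normr0 lee_fin.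
have FTC n : (\int[mu]_(x in I n) (h x)%:E = (H n.+1%:R - H (- n.+1%:R))%:E)%E.
  rewrite (@continuous_FTC2 _ _ H)//.
  - by rewrite (@lt_trans _ _ 0)// ?oppr_lt0.
  - exact: continuous_subspaceT.
  - have cH : continuous H.
      by move=> x; apply/differentiable_continuous/derivable1_diffP.
    split => //; first exact/cvg_at_right_filter/cH.
    exact/cvg_at_left_filter/cH.
  - by move=> x _; rewrite derive1E; apply: derive_val.
have lim2 : (H n.+1%:R - H (- n.+1%:R)) @[n --> \oo] --> 0.
  rewrite -[X in _ --> X]subr0.
  by apply: cvgB; [move: Hy; rewrite -cvg_shiftS|move: HNy; rewrite -cvg_shiftS].
have lim3 : (\int[mu]_(x in I n) (h x)%:E)%E @[n --> \oo] --> (0 : R)%:E.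
  under eq_fun do rewrite FTC.
  by apply: cvg_EFin => //; exact: nearW.
by rewrite /Rintegral (cvg_unique _ lim1 lim3).
Qed.

Lemma is_derive_under_integral (f df : R -> R -> R) (G : R -> R) (t : R) :
  (forall x, mu.-integrable setT (EFin \o f x)) ->
  (forall x y : R, is_derive x (1 : R) (f ^~ y) (df x y)) ->
  (forall y, 0 <= G y) -> mu.-integrable setT (EFin \o G) ->
  (forall x y, `|df x y| <= G y) ->
  is_derive t (1 : R) (fun x => \int[mu]_y f x y) (\int[mu]_y df t y).
Proof.
move=> fi dfE G0 iG Gub.
have I : `]t - 1, t + 1[%classic t by rewrite /= in_itv/=; apply/andP; split; lra.
have d1 x y : partial1of2 f x y = df x y.
  by rewrite partial1of2E; apply: derive_val.
have fd x y : `]t - 1, t + 1[%classic x -> setT y -> derivable (f ^~ y) x 1 by [].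
have fG x y : `]t - 1, t + 1[%classic x -> setT y -> `|partial1of2 f x y| <= G y.
  by rewrite d1.
have fi' x : `]t - 1, t + 1[%classic x -> mu.-integrable setT (EFin \o f x) by [].
have der := derivable_under_integral measurableT I fi' fd G0 iG fG.
have der' := differentiation_under_integral measurableT I fi' fd G0 iG fG.
apply: DeriveDef => //.
rewrite -derive1E der'.
by apply: eq_Rintegral => y _; rewrite d1.
Qed.
End calculus.

(** * The Gaussian density *)

Section gaussian.
Context {R : realType}.
Local Notation mu := (@lebesgue_measure R).
Variable s : R.
Hypothesis s0 : 0 < s.

Let g : R -> R := normal_pdf 0 s.
Let k := normal_peak s.

Let gE y : g y = k * expR (- y ^+ 2 / (s ^+ 2 *+ 2)).
Proof. by rewrite /g normal_pdfE ?gt_eqF// /normal_fun subr0. Qed.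

Let g0 y : 0 <= g y. Proof. exact: normal_pdf_ge0. Qed.

Let k0 : 0 <= k. Proof. exact: normal_peak_ge0. Qed.

Let ks := k * expR (2 * s ^+ 2).

(* 2 |y| <= y^2 / (2 s^2) + 2 s^2, because (|y| - 2 s^2)^2 is nonnegative. *)
Let g_le y : g y <= ks * expR (- (2 * `|y|)).
Proof.
rewrite gE /ks -mulrA ler_wpM2l// -expRD ler_expR.
rewrite -(real_normK (num_real y)).
have s2 : 0 < s ^+ 2 *+ 2 by rewrite mulrn_wgt0// exprn_gt0.
rewrite ler_pdivrMr// -subr_ge0.
have -> : (2 * s ^+ 2 - 2 * `|y|) * (s ^+ 2 *+ 2) - - `|y| ^+ 2 =
  (`|y| - 2 * s ^+ 2) ^+ 2 by ring.
exact: sqr_ge0.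
Qed.

Let yg_le y : `|y| * g y <= ks * expR (- (1 * `|y|)).
Proof.
have ks0 : 0 <= ks by rewrite mulr_ge0// expR_ge0.
apply: (@le_trans _ _ (ks * (`|y| * expR (- (2 * `|y|))))).
  by rewrite mulrCA ler_wpM2l.
rewrite ler_wpM2l//.
have -> : - (2 * `|y|) = - `|y| - `|y| by ring.
rewrite expRD mulrA mul1r ler_piMl ?expR_ge0//.
rewrite expRN ler_pdivrMr ?expR_gt0// mul1r.
by apply: le_trans (expR_ge1Dx _); rewrite lerDr.
Qed.

Let cg : continuous g.
Proof. by apply: continuous_normal_pdf; rewrite gt_eqF. Qed.

Let integrable_bound : mu.-integrable setT (EFin \o (fun y => ks * expR (- (1 * `|y|)))).
Proof.
rewrite /comp; under eq_fun do rewrite EFinM.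
by apply: integrableZl => //; exact: integrable_expR_Nabs.
Qed.

Let integrable_trig_g (f : R -> R) : continuous f -> (forall x, `|f x| <= 1) ->
  mu.-integrable setT (EFin \o (fun y => f y * g y)).
Proof.
move=> cf f1; apply: (@le_integrable _ _ _ mu setT measurableT _ (EFin \o g)) => //.
- apply/measurable_EFinP; apply: continuous_measurable_fun => x.
  by apply: cvgM; [exact: cf|exact: cg].
- by move=> x _ /=; rewrite lee_fin normrM ler_piMl.
- exact: integrable_normal_pdf.
Qed.

Let cts_trig t : continuous (fun y : R => cos (t * y)) /\ continuous (fun y : R => sin (t * y)).
Proof.
have cM : continuous (fun y : R => t * y).
  by move=> y; apply: cvgM; [exact: cst_continuous|exact: cvg_id].
by split => y; apply: continuous_comp; [exact: cM|exact: continuous_cos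
   |exact: cM|exact: continuous_sin].
Qed.

Let integrable_ysin t : mu.-integrable setT (EFin \o (fun y => y * sin (t * y) * g y)).
Proof.
apply: (le_integrable measurableT _ _ integrable_bound) => //.
- apply/measurable_EFinP; apply: continuous_measurable_fun => x.
  apply: cvgM; last exact: cg.
  by apply: cvgM; [exact: cvg_id|exact: (cts_trig t).2].
- move=> y _ /=; rewrite lee_fin [leRHS]ger0_norm ?normrM.
    apply: le_trans (yg_le y).
    by rewrite (ger0_norm (g0 _)) ler_wpM2r// ler_piMr// sin_max.
  by rewrite !mulr_ge0 ?expR_ge0.
Qed.

Let g_le1 y : g y <= ks * expR (- (1 * `|y|)).
Proof.
have ks0 : 0 <= ks by rewrite mulr_ge0// expR_ge0.
apply: le_trans (g_le y) _; apply: ler_wpM2l => //.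
by rewrite ler_expR lerN2; apply: ler_wpM2r => //; rewrite ler1n.
Qed.

Let cvg_decay (f u : nat -> R) (A : R) : (forall n, `|u n| = n%:R) ->
  (forall n, `|f n| <= A * (ks * expR (- (1 * `|u n|)))) -> f n @[n --> \oo] --> 0.
Proof.
move=> un fA; apply: norm_cvg0.
apply: (@squeeze_cvgr _ _ _ _ (cst 0) (fun n => A * ks * expR (- n%:R))).
- apply: nearW => n; rewrite normr_ge0/=.
  by apply: le_trans (fA n) _; rewrite un mul1r mulrA.
- exact: cvg_cst.
- rewrite -[X in _ --> X](mulr0 (A * ks)).
  by apply: cvgMr; exact: cvgn_expR.
Qed.

Let g_derive y : is_derive y (1 : R) g (- (y / s ^+ 2) * g y).
Proof.
have sn0 : s != 0 by rewrite gt_eqF.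
have -> : g = (fun y => k * expR (- y ^+ 2 / (s ^+ 2 *+ 2))) by apply/funext => z; rewrite gE.
by apply: trigger_derive; rewrite /GRing.scale/=; field.
Qed.

Let integrable_yg : mu.-integrable setT (EFin \o (fun y => y * g y)).
Proof.
apply: (le_integrable measurableT _ _ integrable_bound) => //.
- apply/measurable_EFinP; apply: continuous_measurable_fun => x.
  by apply: cvgM; [exact: cvg_id|exact: cg].
- move=> y _ /=; rewrite lee_fin [leRHS]ger0_norm ?normrM.
    by apply: le_trans (yg_le y); rewrite (ger0_norm (g0 _)).
  by rewrite !mulr_ge0 ?expR_ge0.
Qed.

Let integrable_y2g : mu.-integrable setT (EFin \o (fun y => y ^+ 2 * g y)).
Proof.
have ib : mu.-integrable setT (EFin \o (fun y => 2 * (ks * expR (- (1 * `|y|))))).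
  by rewrite /comp; under eq_fun do rewrite EFinM; apply: integrableZl.
apply: (le_integrable measurableT _ _ ib) => //.
- apply/measurable_EFinP; apply: continuous_measurable_fun => x.
  by apply: cvgM; [exact: exprn_continuous|exact: cg].
- move=> y _; rewrite lee_fin [leRHS]ger0_norm; last first.
    by rewrite !mulr_ge0 ?expR_ge0.
  rewrite ger0_norm; last by rewrite mulr_ge0// sqr_ge0.
  apply: (@le_trans _ _ (y ^+ 2 * (ks * expR (- (2 * `|y|))))).
    by rewrite ler_wpM2l// sqr_ge0.
  have ks0 : 0 <= ks by rewrite mulr_ge0// expR_ge0.
  rewrite mulrCA [leRHS]mulrCA ler_wpM2l//.
  have -> : - (2 * `|y|) = - `|y| - `|y| by ring.
  rewrite expRD mulrA mul1r ler_wpM2r ?expR_ge0//.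
  rewrite expRN ler_pdivrMr ?expR_gt0//.
  have := expR_ge1Dxn 1 (normr_ge0 y); rewrite real_normK ?num_real// !factS fact0 => H.
  by nra.
Qed.

(** The integrand is the derivative of - s^2 times the density. *)
Lemma gaussian_mean : \int[mu]_y (y * normal_pdf 0 s y) = 0.
Proof.
have sn0 : s != 0 by rewrite gt_eqF.
have lim0 (u : nat -> R) : (forall n, `|u n| = n%:R) ->
    - s ^+ 2 * g (u n) @[n --> \oo] --> 0.
  move=> un; apply: (cvg_decay (A := s ^+ 2) un) => n.
  rewrite normrM normrN (ger0_norm (sqr_ge0 s)) (ger0_norm (g0 _)).
  by apply: ler_wpM2l; [exact: sqr_ge0|exact: g_le1].
apply: (@integral_derive0 _ (fun y => - s ^+ 2 * g y) (fun y => y * g y)).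
- by move=> y; have dg := g_derive y; apply: trigger_derive; rewrite /GRing.scale/= -/g; field.
- by move=> y; apply: cvgM; [exact: cvg_id|exact: cg].
- exact: integrable_yg.
- by apply: lim0 => n; rewrite normr_nat.
- by apply: lim0 => n; rewrite normrN normr_nat.
Qed.

(** s^2 g(y) - y^2 g(y) is the derivative of s^2 y g(y), g being the density. *)
Lemma gaussian_moment2 : (\int[mu]_y (y ^+ 2 * normal_pdf 0 s y)%:E = (s ^+ 2)%:E)%E.
Proof.
have sn0 : s != 0 by rewrite gt_eqF.
have ig : mu.-integrable setT (EFin \o g) by exact: integrable_normal_pdf.
have iz : mu.-integrable setT (EFin \o (fun y => s ^+ 2 * g y)).
  by rewrite /comp; under eq_fun do rewrite EFinM; apply: integrableZl.
have lim0 (u : nat -> R) : (forall n, `|u n| = n%:R) ->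
    s ^+ 2 * (u n * g (u n)) @[n --> \oo] --> 0.
  move=> un; apply: (cvg_decay (A := s ^+ 2) un) => n.
  rewrite normrM (ger0_norm (sqr_ge0 s)) normrM (ger0_norm (g0 _)).
  by apply: ler_wpM2l; [exact: sqr_ge0|exact: yg_le].
have : \int[mu]_y (s ^+ 2 * g y - y ^+ 2 * g y) = 0.
  apply: (@integral_derive0 _ (fun y => s ^+ 2 * (y * g y))
    (fun y => s ^+ 2 * g y - y ^+ 2 * g y)).
  - by move=> y; have dg := g_derive y; apply: trigger_derive; rewrite /GRing.scale/=; field.
  - move=> y; apply: cvgB; apply: cvgM; try exact: cg; first exact: cvg_cst.
    exact: exprn_continuous.
  - rewrite /comp; under eq_fun do rewrite EFinB.
    exact: (integrableB measurableT iz integrable_y2g).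
  - by apply: lim0 => n; rewrite normr_nat.
  - by apply: lim0 => n; rewrite normrN normr_nat.
rewrite RintegralB// RintegralZl// => /eqP; rewrite subr_eq0 => /eqP E.
rewrite -[LHS]fineK; last exact: (integrable_fin_num measurableT integrable_y2g).
rewrite -/(Rintegral _ _ _) -E /Rintegral integral_normal_pdf/= mulr1//.
Qed.

Let F t := \int[mu]_y (cos (t * y) * g y).

Let F_derive t : is_derive t (1 : R) F (- \int[mu]_y (y * sin (t * y) * g y)).
Proof.
have -> : - (\int[mu]_y (y * sin (t * y) * g y)) = \int[mu]_y (- (y * sin (t * y) * g y)).
  under [RHS]eq_Rintegral do rewrite -mulN1r.
  by rewrite RintegralZl// mulN1r.
apply: (@is_derive_under_integral _ (fun t y => cos (t * y) * g y)
  (fun t y => - (y * sin (t * y) * g y)) (fun y => ks * expR (- (1 * `|y|)))).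
- by move=> x; apply: integrable_trig_g; [exact: (cts_trig x).1|move=> ?; exact: cos_max].
- move=> x y; apply: trigger_derive; rewrite /GRing.scale/=; ring.
- by move=> y; rewrite !mulr_ge0 ?expR_ge0.
- exact: integrable_bound.
- move=> x y; rewrite normrN !normrM; apply: le_trans (yg_le y).
  by rewrite (ger0_norm (g0 _)) ler_wpM2r// ler_piMr// sin_max.
Qed.

(* Integration by parts of sin (t y) against the density. *)
Let parts t : \int[mu]_y (y * sin (t * y) * g y) = s ^+ 2 * t * F t.
Proof.
have sn0 : s != 0 by rewrite gt_eqF.
have i1 : mu.-integrable setT (EFin \o (fun y => s ^+ 2 * t * (cos (t * y) * g y))).
  rewrite /comp; under eq_fun do rewrite EFinM.
  apply: integrableZl; first exact: measurableT.
  apply: integrable_trig_g; first exact: (cts_trig t).1.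
  by move=> ?; exact: cos_max.
have lim0 (u : nat -> R) : (forall n, `|u n| = n%:R) ->
    s ^+ 2 * sin (t * u n) * g (u n) @[n --> \oo] --> 0.
  move=> un; apply: (cvg_decay (A := s ^+ 2) un) => n.
  rewrite 2!normrM (ger0_norm (sqr_ge0 s)) (ger0_norm (g0 _)) -mulrA.
  apply: ler_wpM2l; first exact: sqr_ge0.
  by apply: le_trans (g_le1 _); rewrite ler_piMl// sin_max.
have : \int[mu]_y (s ^+ 2 * t * (cos (t * y) * g y) - y * sin (t * y) * g y) = 0.
  apply: (@integral_derive0 _ (fun y => s ^+ 2 * sin (t * y) * g y)
    (fun y => s ^+ 2 * t * (cos (t * y) * g y) - y * sin (t * y) * g y)).
  - move=> y.
    have -> : (fun y => s ^+ 2 * sin (t * y) * g y) =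
      (fun y => s ^+ 2 * sin (t * y) * (k * expR (- y ^+ 2 / (s ^+ 2 *+ 2)))).
      by apply/funext => z; rewrite gE.
    rewrite gE.
    apply: trigger_derive; rewrite /GRing.scale/=.
    by field.
  - move=> y; apply: cvgB.
      apply: cvgM; first exact: cvg_cst.
      by apply: cvgM; [exact: (cts_trig t).1|exact: cg].
    apply: cvgM; last exact: cg.
    by apply: cvgM; [exact: cvg_id|exact: (cts_trig t).2].
  - rewrite /comp; under eq_fun do rewrite EFinB.
    exact: (integrableB measurableT i1 (integrable_ysin t)).
  - by apply: lim0 => n; rewrite normr_nat.
  - by apply: lim0 => n; rewrite normrN normr_nat.
rewrite RintegralB// RintegralZl//; last first.
  apply: integrable_trig_g; first exact: (cts_trig t).1.
  by move=> ?; exact: cos_max.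
by rewrite -/(F t) => ?; lra.
Qed.

(** The left-hand side F satisfies F' t = - s^2 t (F t), so that
    F t * exp (s^2 t^2 / 2) is constant. *)
Lemma gaussian_cos t : \int[mu]_y (cos (t * y) * normal_pdf 0 s y) =
  expR (- (s ^+ 2 * t ^+ 2 / 2)).
Proof.
have F0 : F 0 = 1.
  rewrite /F; under eq_Rintegral do rewrite mul0r cos0 mul1r.
  by rewrite /Rintegral /g integral_normal_pdf.
have dK (x : R) : is_derive x (1 : R) (fun t => F t * expR (s ^+ 2 * t ^+ 2 / 2)) 0.
  have dF := F_derive x; rewrite parts in dF.
  by apply: trigger_derive; rewrite /GRing.scale/=; field.
have := is_derive_0_is_cst t 0 dK.
rewrite F0 expr0n/= mulr0 mul0r expR0 mulr1 => FE.
rewrite expRN -div1r; apply: (canRL (mulfK _)) => //.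
by rewrite gt_eqF// expR_gt0.
Qed.

End gaussian.

(** * Powers as scale mixtures of a kernel *)

Section scale_mixture.
Context {R : realType}.
Local Notation mu := (@lebesgue_measure R).

(** The integral of K (l a) l^(- p - 1) over l > 0, written in the variable
    u = ln l; with the integral over the whole line, rescaling a becomes a
    translation of u. *)
Definition mellin (K : R -> R) (p a : R) : \bar R :=
  (\int[mu]_u (K (expR u * a) * expR (- (p * u)))%:E)%E.

Variables (K : R -> R) (p : R).
Hypothesis cK : continuous K.
Hypothesis K0 : forall x, 0 <= K x.

Lemma continuous_mellin a : continuous (fun u : R => K (expR u * a) * expR (- (p * u))).
Proof.
move=> u; apply: cvgM.
  apply: continuous_comp; last exact: cK.
  by apply: cvgM; [exact: continuous_expR|exact: cvg_cst].
apply: continuous_comp; last exact: continuous_expR.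
by apply: cvgN; apply: cvgM; [exact: cvg_cst|exact: cvg_id].
Qed.

Lemma mellin_scale a : 0 < a -> mellin K p a = ((a `^ p)%:E * mellin K p 1)%E.
Proof.
move=> a0.
have E1 : mellin K p 1 = (\int[mu]_u ((a `^ (- p)) * (K (expR u * a) * expR (- (p * u))))%:E)%E.
  rewrite /mellin.
  pose F (u : R) := u + ln a.
  have F' : (F^`())%classic = cst 1.
    apply/funext => u; rewrite derive1E; apply: derive_val.
    by apply: trigger_derive; rewrite addr0.
  rewrite (@increasing_ge0_integration_by_substitutionT _ F
    (fun u => K (expR u * 1) * expR (- (p * u)))).
  - apply: eq_integral => u _; congr EFin.
    rewrite !fctE F' /= mulr1 /F expRD lnK ?posrE// mulr1.
    rewrite mulrCA; congr (_ * _).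
    rewrite mulrDr opprD expRD mulrC; congr (_ * _).
    by rewrite powRN /powR gt_eqF// -expRN.
  - by move=> x y xy; rewrite /F ltrD2r.
  - by rewrite F'; move=> x; exact: cvg_cst.
  - by rewrite F'; exact: is_cvg_cst.
  - by rewrite F'; exact: is_cvg_cst.
  - by move=> x; apply: ex_derive.
  - exact: cvg_addrr_Ny.
  - exact: cvg_addrr.
  - exact: continuous_mellin.
  - by move=> x; rewrite mulr_ge0// expR_ge0.
have mf : measurable_fun setT (EFin \o (fun u : R => K (expR u * a) * expR (- (p * u)))).
  apply/measurable_EFinP; exact: (continuous_measurable_fun (@continuous_mellin a)).
rewrite E1; under eq_integral do rewrite EFinM.
rewrite ge0_integralZl//.
- by rewrite muleA -EFinM powRN mulfV ?mul1e// gt_eqF// powR_gt0.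
- by move=> u _; rewrite lee_fin mulr_ge0// expR_ge0.
- by rewrite lee_fin powR_ge0.
Qed.

Lemma mellin_ge0 a : (0 <= mellin K p a)%E.
Proof. by apply: integral_ge0 => u _; rewrite lee_fin mulr_ge0// expR_ge0. Qed.

Lemma mellin_lty (A c : R) : 0 < c ->
  (forall u, K (expR u) * expR (- (p * u)) <= A * expR (- (c * `|u|))) ->
  (mellin K p 1 < +oo)%E.
Proof.
move=> c0 Kle.
have A0 : 0 <= A.
  have := le_trans (mulr_ge0 (K0 _) (expR_ge0 _)) (Kle 0).
  by rewrite normr0 mulr0 oppr0 expR0 mulr1.
have iA : mu.-integrable setT (EFin \o (fun u => A * expR (- (c * `|u|)))).
  rewrite /comp; under eq_fun do rewrite EFinM.
  by apply: integrableZl => //; exact: integrable_expR_Nabs.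
have : mu.-integrable setT (EFin \o (fun u => K (expR u * 1) * expR (- (p * u)))).
  apply: (le_integrable measurableT _ _ iA) => //.
  - apply/measurable_EFinP; exact: (continuous_measurable_fun (@continuous_mellin 1)).
  - move=> u _ /=; rewrite lee_fin mulr1 ger0_norm; last first.
      by rewrite mulr_ge0// expR_ge0.
    by rewrite (le_trans (Kle u))// ler_norm.
move/integrableP => [_]; apply: le_lt_trans.
rewrite /mellin le_eqVlt; apply/orP; left; apply/eqP.
apply: eq_integral => u _.
by rewrite /= ger0_norm// mulr_ge0// expR_ge0.
Qed.

Lemma mellin_gt0 : (forall x, 0 < x <= 1 -> 0 < K x) -> (0 < mellin K p 1)%E.
Proof.
move=> Kpos; rewrite lt0e mellin_ge0 andbT; apply/eqP => M0.
pose f u := (K (expR u * 1) * expR (- (p * u)))%:E.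
have mf : measurable_fun setT f.
  apply/measurable_EFinP; exact: (continuous_measurable_fun (@continuous_mellin 1)).
have /(ae_eq_integral_abs mu measurableT mf) : (\int[mu]_x `|f x| = 0)%E.
  rewrite -M0; apply: eq_integral => u _.
  by rewrite /= ger0_norm// mulr_ge0// expR_ge0.
case=> N [mN N0 fN].
have : (mu `[(-1)%R, 0%R]%classic <= mu N)%E.
  apply: le_measure; rewrite ?inE//.
  move=> u /=; rewrite in_itv/= => /andP[_ u0]; apply: fN => /=.
  apply/not_implyP; split => //; rewrite /f => -[] /eqP.
  rewrite mulf_eq0 [in X in _ || X]gt_eqF ?expR_gt0// orbF mulr1 gt_eqF//.
  by apply: Kpos; rewrite expR_gt0/= -expR0 ler_expR.
rewrite N0 lebesgue_measure_itv/= lte_fin oppr_lt0 ltr01.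
by rewrite add0e lee_fin opprK ler10.
Qed.

End scale_mixture.

(** * Moments as mixtures *)

Section mixture.
Context {R : realType}.
Local Notation mu := (@lebesgue_measure R).
Variables (K : R -> R) (p : R).
Hypothesis cK : continuous K.
Hypothesis K0 : forall x, 0 <= K x.
Hypothesis evenK : forall x, K (- x) = K x.
Hypothesis K_lty : (mellin K p 1 < +oo)%E.
Hypothesis K_gt0 : (0 < mellin K p 1)%E.
Hypothesis K_zero : mellin K p 0 = (epow 0%:E p * mellin K p 1)%E.

Let C := fine (mellin K p 1).
Let CE : mellin K p 1 = C%:E.
Proof. by rewrite /C fineK// ge0_fin_numE// ltW. Qed.
Let C0 : 0 < C. Proof. by rewrite -lte_fin -CE. Qed.

Let mellin_epow (w : R) : (C^-1%:E * mellin K p `|w| = epow `|w|%:E p)%E.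
Proof.
have [->|w0] := eqVneq w 0.
  rewrite normr0 K_zero CE muleCA -EFinM mulVf ?mule1// gt_eqF//.
rewrite mellin_scale ?normr_gt0// CE muleCA -EFinM mulVf ?mule1 ?gt_eqF//.
rewrite mulr1 /epow; case: ifPn => _; rewrite poweR_EFin//.
rewrite inver powR_eq0 normr_eq0 (negbTE w0)/= powRN.
by rewrite invrK.
Qed.

Section one_variable.
Context d (T : measurableType d) (P : probability T R) (W : T -> R).
Hypothesis mW : measurable_fun setT W.

Let f (z : T * measurableTypeR R) : \bar R :=
  (K (expR z.2 * `|W z.1|) * expR (- (p * z.2)))%:E.

Let f0 z : (0 <= f z)%E.
Proof. by rewrite lee_fin mulr_ge0// expR_ge0. Qed.

Let mf : measurable_fun setT f.
Proof.
apply/measurable_EFinP; apply: measurable_funM.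
  apply: (measurableT_comp (continuous_measurable_fun cK)).
  apply: measurable_funM.
    exact: (measurableT_comp (continuous_measurable_fun (@continuous_expR R)) measurable_snd).
  apply: (measurableT_comp (@normr_measurable R setT)).
  exact: (measurableT_comp mW measurable_fst).
apply: (measurableT_comp (continuous_measurable_fun (@continuous_expR R))).
apply: (measurableT_comp (@oppr_measurable _ setT)).
by apply: measurable_funM => //; exact: measurable_snd.
Qed.

(* The mean of the mixture's integrand at scale e^u. *)
Let inner (u : R) : \bar R := ((\int[P]_w (K (expR u * W w))%:E) * (expR (- (p * u)))%:E)%E.

Let innerE (u : R) : inner u = (\int[P]_w f (w, u))%E.
Proof.
rewrite /inner -ge0_integralZr//.
- apply: eq_integral => w _; rewrite /f/= -EFinM; congr (_ * _)%:E.
  by case: (ger0P (W w)) => // _; rewrite mulrN evenK.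
- apply/measurable_EFinP.
  apply: (measurableT_comp (continuous_measurable_fun cK)).
  exact: measurable_funM.
- by move=> w _; rewrite lee_fin.
Qed.

Lemma measurable_inner : measurable_fun setT inner.
Proof.
have -> : inner = fubini_G P f by apply/funext => u; rewrite innerE.
exact: measurable_fun_fubini_tonelli_G.
Qed.

Lemma abs_moment_mixture : abs_moment P W p = (C^-1%:E * \int[mu]_u inner u)%E.
Proof.
rewrite /abs_moment.
under eq_integral do rewrite -mellin_epow.
rewrite ge0_integralZl//.
- congr (_ * _)%E.
  under [RHS]eq_integral do rewrite innerE.
  exact: (fubini_tonelli f mf f0).
- exact: (measurable_fun_fubini_tonelli_F f mf f0).
- by move=> w _; exact: mellin_ge0.
- by rewrite lee_fin invr_ge0 ltW.
Qed.

Lemma inner_ge0 (u : R) : (0 <= inner u)%E.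
Proof.
apply: mule_ge0; last by rewrite lee_fin expR_ge0.
by apply: integral_ge0 => w _; rewrite lee_fin.
Qed.

End one_variable.

(** If the kernel means are ordered at every scale, so are the moments. *)
Lemma le_abs_moment_mixture d1 d2 (T1 : measurableType d1) (T2 : measurableType d2)
    (P1 : probability T1 R) (P2 : probability T2 R) (V : T1 -> R) (W : T2 -> R) :
  measurable_fun setT V -> measurable_fun setT W ->
  (forall t, \int[P1]_w (K (t * V w))%:E <= \int[P2]_w (K (t * W w))%:E)%E ->
  (abs_moment P1 V p <= abs_moment P2 W p)%E.
Proof.
move=> mV mW KVW; rewrite !abs_moment_mixture//.
apply: lee_wpmul2l; first by rewrite lee_fin invr_ge0 ltW.
apply: ge0_le_integral => //.
- by move=> u _; exact: inner_ge0.
- exact: measurable_inner.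
- exact: measurable_inner.
- by move=> u _; apply: lee_wpmul2r; rewrite ?lee_fin ?expR_ge0.
Qed.

End mixture.

(** * Second moments and characteristic functions *)

Section trig_bounds.
Context {R : realType}.

Lemma cos_double (x : R) : 1 - cos x = 2 * sin (x / 2) ^+ 2.
Proof.
have {1}-> : x = (x / 2) *+ 2 by rewrite -mulr_natr divfK.
by rewrite cos_mulr2n cos2sin2; ring.
Qed.

Lemma normr_sin_le (x : R) : `|sin x| <= `|x|.
Proof.
wlog x0 : x / 0 <= x.
  move=> H; have [/H//|x0] := leP 0 x.
  by rewrite -normrN -sinN -(normrN x); apply: H; rewrite oppr_ge0 ltW.
have [|c _] := @MVT_segment R sin cos 0 x x0.
  by apply: continuous_subspaceT; exact: continuous_sin.
by rewrite sin0 !subr0 => ->; rewrite normrM ler_piMl// cos_max.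
Qed.

Lemma one_minus_cos_ge0 (x : R) : 0 <= 1 - cos x.
Proof. by rewrite subr_ge0 cos_le1. Qed.

Lemma one_minus_cos_le2 (x : R) : 1 - cos x <= 2.
Proof. by have := cos_max x; rewrite ler_norml => /andP[? _]; lra. Qed.

Lemma one_minus_cos_le (x : R) : 1 - cos x <= x ^+ 2 / 2.
Proof.
rewrite cos_double.
have -> : x ^+ 2 / 2 = 2 * (x / 2) ^+ 2 by field.
rewrite ler_wpM2l// -(real_normK (num_real (sin _))) -(real_normK (num_real (x / 2))).
by rewrite ler_pXn2r// ?nnegrE//; exact: normr_sin_le.
Qed.

Lemma one_minus_cos_gt0 (x : R) : 0 < x <= 1 -> 0 < 1 - cos x.
Proof.
move=> /andP[x0 x1]; rewrite cos_double mulr_gt0// exprn_gt0//.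
by apply: sin_gt0_pi; have := pi_ge2 R; lra.
Qed.

Lemma cvg_one_minus_cos (a : R) :
  (n.+1%:R ^+ 2 * (1 - cos (a / n.+1%:R))) @[n --> \oo] --> a ^+ 2 / 2.
Proof.
have sl : (n.+1%:R * sin (a / 2 / n.+1%:R)) @[n --> \oo] --> a / 2.
  have der : is_derive (0 : R) (1 : R) (fun h => sin (a / 2 * h)) (a / 2).
    apply: trigger_derive; rewrite /GRing.scale/= mulr0 cos0; ring.
  have [/cvg_ex[l Hl] E] := der.
  have El : l = a / 2.
    by rewrite -E; apply/esym/cvg_lim.
  rewrite El in Hl.
  move/cvgr_dnbhsP : Hl => /(_ (fun n => n.+1%:R^-1)) Hl.
  have n0 n : n.+1%:R^-1 != 0 :> R by rewrite invr_neq0// pnatr_eq0.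
  have := Hl (conj n0 cvg_harmonic).
  apply: cvg_trans; apply: near_eq_cvg; apply: nearW => n /=.
  by rewrite mulr0 sin0 subr0 invrK scaler1 addr0.
have -> : (fun n => n.+1%:R ^+ 2 * (1 - cos (a / n.+1%:R))) =
    (fun n => 2 * (n.+1%:R * sin (a / 2 / n.+1%:R)) ^+ 2).
  by apply/funext => n; rewrite cos_double (mulrAC a); ring.
have -> : a ^+ 2 / 2 = 2 * (a / 2) ^+ 2 by field.
by apply: cvgM; [exact: cvg_cst|rewrite expr2; apply: cvgM].
Qed.

End trig_bounds.

Section deficit.
Context {R : realType} d (T : measurableType d) (P : probability T R) (W : T -> R).
Hypothesis mW : measurable_fun setT W.

Let mcos t : measurable_fun setT (fun w => 1 - cos (t * W w)).
Proof.
by apply: measurable_funB => //; exact: measurable_cosM.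
Qed.

Lemma integral_deficit t :
  (\int[P]_w (1 - cos (t * W w))%:E = (1 - chf P W t)%:E)%E.
Proof.
have ic := integrable_cosM P t mW.
have i1 : P.-integrable setT (EFin \o (fun _ => 1 : R)).
  exact: finite_measure_integrable_cst.
under eq_integral do rewrite EFinB.
rewrite integralB// integral_probability_cst1 EFinB /chf.
by rewrite fineK// integrable_fin_num.
Qed.

Lemma chf_le1 t : chf P W t <= 1.
Proof.
rewrite -subr_ge0 -lee_fin -integral_deficit; apply: integral_ge0 => w _.
by rewrite lee_fin one_minus_cos_ge0.
Qed.

Lemma moment2E : abs_moment P W 2 = (\int[P]_w (W w ^+ 2)%:E)%E.
Proof.
apply: eq_integral => w _; rewrite /epow ltNge ler0n/=.
by rewrite powR_mulrn// real_normK// num_real.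
Qed.

Lemma deficit_le_moment2 t :
  ((1 - chf P W t)%:E <= (t ^+ 2 / 2)%:E * abs_moment P W 2)%E.
Proof.
rewrite -integral_deficit moment2E -ge0_integralZl//.
- apply: ge0_le_integral => //.
  + by apply/measurable_EFinP; exact: (@mcos t).
  + apply: measurable_funeM; apply/measurable_EFinP; exact: measurable_funM.
  + move=> w _; rewrite -EFinM lee_fin (le_trans (one_minus_cos_le _))//.
    by rewrite exprMn mulrAC.
- by apply/measurable_EFinP; apply: measurable_funM.
- by move=> w _; rewrite lee_fin sqr_ge0.
- by rewrite lee_fin divr_ge0// sqr_ge0.
Qed.

(** The bounds are on quantities that tend to t^2 / 2 * E W^2, and Fatou's lemma
    applies; the second moment is not assumed finite. *)
Lemma moment2_le_deficit t (B : \bar R) :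
  (forall n : nat, (n.+1%:R ^+ 2 * (1 - chf P W (t / n.+1%:R)))%:E <= B)%E ->
  ((t ^+ 2 / 2)%:E * abs_moment P W 2 <= B)%E.
Proof.
move=> leB.
pose f n w := (n.+1%:R ^+ 2 * (1 - cos (t / n.+1%:R * W w)))%:E : \bar R.
have mf n : measurable_fun setT (f n).
  by apply/measurable_EFinP; apply: measurable_funM.
have f0 n w : setT w -> (0 <= f n w)%E.
  by move=> _; rewrite lee_fin mulr_ge0// ?one_minus_cos_ge0// sqr_ge0.
have := fatou P measurableT mf f0.
have -> : (\int[P]_w limn_einf (f ^~ w) = (t ^+ 2 / 2)%:E * abs_moment P W 2)%E.
  rewrite moment2E -ge0_integralZl//.
  - apply: eq_integral => w _.
    have fl : f n w @[n --> \oo] --> ((t * W w) ^+ 2 / 2)%:E.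
      apply: cvg_EFin; first exact: nearW.
      have := @cvg_one_minus_cos R (t * W w).
      by apply: cvg_trans; apply: near_eq_cvg; apply: nearW => n; rewrite /= (mulrAC t).
    by rewrite (cvg_limn_einf_sup fl).1 -EFinM exprMn mulrAC.
  - by apply/measurable_EFinP; apply: measurable_funM.
  - by move=> w _; rewrite lee_fin sqr_ge0.
  - by rewrite lee_fin divr_ge0// sqr_ge0.
move=> /le_trans; apply.
rewrite limn_einf_lim.
apply: lime_le; first exact: is_cvg_einfs.
apply: nearW => n; apply: le_trans (leB n).
apply: ereal_inf_lbound; exists n => //=.
rewrite /f; under eq_integral do rewrite EFinM.
rewrite ge0_integralZl//.
- by rewrite integral_deficit EFinM.
- by apply/measurable_EFinP; exact: (@mcos (t / n.+1%:R)).
Qed.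

End deficit.

(** * Comparison of moments through characteristic functions *)

Section kernels.
Context {R : realType}.
Local Notation mu := (@lebesgue_measure R).

(** The kernel used for exponents between 0 and 2. *)
Definition ckernel (x : R) : R := 1 - cos x.

Lemma continuous_ckernel : continuous ckernel.
Proof. by move=> x; apply: cvgB; [exact: cvg_cst|exact: continuous_cos]. Qed.

(** The integrand is at most 2 e^(- p u), and at most e^((2 - p) u) / 2 because
    1 - cos x <= x^2 / 2. *)
Lemma mellin_ckernel_lty (p : R) : 0 < p < 2 -> (mellin ckernel p 1 < +oo)%E.
Proof.
move=> /andP[p0 p2].
apply: (@mellin_lty _ _ _ continuous_ckernel one_minus_cos_ge0 2 (Num.min p (2 - p))).
  by rewrite lt_min p0 subr_gt0.
move=> u; have [u0|u0] := ltP 0 u.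
  apply: ler_pM; rewrite ?one_minus_cos_ge0 ?expR_ge0 ?one_minus_cos_le2//.
  by rewrite ler_expR lerN2 gtr0_norm// ler_pM2r// ge_min lexx.
apply: (@le_trans _ _ (expR (2 * u) * expR (- (p * u)))).
  rewrite ler_wpM2r ?expR_ge0// (le_trans (one_minus_cos_le _))//.
  rewrite ler_pdivrMr// expRM_natl ler_peMr ?sqr_ge0//.
  by rewrite ler1n.
rewrite -expRD; apply: (@le_trans _ _ (expR (- (Num.min p (2 - p) * `|u|)))); last first.
  by rewrite ler_peMl ?expR_ge0// ler1n.
rewrite ler_expR ler0_norm// mulrN opprK.
have -> : 2 * u - p * u = (2 - p) * u by ring.
by rewrite ler_wnM2r// ge_min lexx orbT.
Qed.

(** The kernel used for negative exponents. *)
Definition gkernel (x : R) : R := expR (- (x ^+ 2 / 2)).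

Lemma continuous_gkernel : continuous gkernel.
Proof.
move=> x; apply: continuous_comp; last exact: continuous_expR.
by apply: cvgN; apply: cvgM; [exact: exprn_continuous|exact: cvg_cst].
Qed.

Lemma gkernel_ge0 x : 0 <= gkernel x. Proof. exact: expR_ge0. Qed.

Lemma mellin_gkernel_lty (p : R) : -1 < p < 0 -> (mellin gkernel p 1 < +oo)%E.
Proof.
move=> /andP[p1 p0].
apply: (@mellin_lty _ _ _ continuous_gkernel gkernel_ge0 8 (- p)).
  by rewrite oppr_gt0.
move=> u; have [u0|u0] := ltP 0 u.
  rewrite gtr0_norm// mulNr opprK.
  (* exp (x^2 / 2) >= (x^2 / 2)^2 / 2 = x^4 / 8, with x = e^u. *)
  have E8 : gkernel (expR u) <= 8 * expR (- (4 * u)).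
    rewrite /gkernel expRN expRN ler_pdivlMr ?expR_gt0//.
    have x0 : 0 <= expR u ^+ 2 / 2 by rewrite divr_ge0// sqr_ge0.
    have := expR_ge1Dxn 1 x0.
    rewrite ler_pdivrMl ?expR_gt0// expRM_natl => H.
    apply: (@le_trans _ _ (8 * (1 + (expR u ^+ 2 / 2) ^+ 2 / 2`!%:R))).
      rewrite !factS fact0; nra.
    rewrite [leRHS]mulrC; apply: ler_wpM2l => //.
  apply: (@le_trans _ _ (8 * expR (- (4 * u)) * expR (- (p * u)))).
    by apply: ler_wpM2r E8; exact: expR_ge0.
  rewrite -mulrA ler_wpM2l// -expRD ler_expR.
  by nra.
apply: (@le_trans _ _ (1 * expR (- (p * u)))).
  rewrite ler_wpM2r ?expR_ge0// /gkernel -expR0 ler_expR.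
  by rewrite oppr_le0 divr_ge0// sqr_ge0.
rewrite ler_pM ?expR_ge0//; first by rewrite ler1n.
by rewrite ler0_norm// mulrN mulNr !opprK.
Qed.

Lemma mellin_ckernel0 (p : R) : mellin ckernel p 0 = 0%E.
Proof. by apply: integral0_eq => u _; rewrite /ckernel mulr0 cos0 subrr mul0r. Qed.

(** At the origin the mixture diverges, in agreement with 0^p = +oo for p < 0. *)
Lemma mellin_gkernel0 (p : R) : p < 0 -> mellin gkernel p 0 = +oo%E.
Proof.
move=> p0; apply/eqP; rewrite -leye_eq.
have <- : (mu `[0%R, +oo[%classic = +oo)%E.
  rewrite lebesgue_measure_itv/=. by rewrite ltry.
rewrite -[leLHS]mul1e -integral_cst//.
have mf : measurable_fun setT (EFin \o (fun u : R => gkernel (expR u * 0) * expR (- (p * u)))).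
  by apply/measurable_EFinP; exact: (continuous_measurable_fun (@continuous_mellin _ _ p continuous_gkernel 0)).
apply: (@le_trans _ _ (\int[mu]_(u in `[0%R, +oo[) (gkernel (expR u * 0) * expR (- (p * u)))%:E)%E).
  apply: ge0_le_integral => //.
  - by apply: measurable_funTS.
  - move=> u; rewrite /= in_itv/= andbT => u0.
    rewrite mulr0 /gkernel expr0n/= mul0r oppr0 expR0 mul1r lee_fin -expR0 ler_expR.
    by rewrite oppr_ge0 mulr_le0_ge0// ltW.
apply: ge0_subset_integral => //.
by move=> u _; rewrite lee_fin; apply: mulr_ge0; [exact: gkernel_ge0|exact: expR_ge0].
Qed.

End kernels.

Section gaussian_average.
Context {R : realType} d (T : measurableType d) (P : probability T R) (W : T -> R).
Hypothesis mW : measurable_fun setT W.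
Local Notation mu := (@lebesgue_measure R).
Local Notation g := (@normal_pdf R 0 1).

Let f t (z : T * measurableTypeR R) : \bar R :=
  (ckernel (t * W z.1 * z.2) * g z.2)%:E.

Let f0 t z : (0 <= f t z)%E.
Proof. by rewrite lee_fin mulr_ge0// ?one_minus_cos_ge0// normal_pdf_ge0. Qed.

Let mf t : measurable_fun setT (f t).
Proof.
apply/measurable_EFinP; apply: measurable_funM.
  apply: (measurableT_comp (continuous_measurable_fun (@continuous_ckernel R))).
  apply: measurable_funM; last exact: measurable_snd.
  apply: measurable_funM => //.
  exact: (measurableT_comp mW measurable_fst).
exact: (measurableT_comp (@measurable_normal_pdf R 0 1) measurable_snd).
Qed.

(* A Gaussian kernel is a Gaussian average of cosines. *)
Let gkernelE a : (1 - gkernel a)%:E = (\int[mu]_y (ckernel (a * y) * g y)%:E)%E.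
Proof.
have i1 := @integrable_normal_pdf R 0 1.
have cg : continuous g by apply: continuous_normal_pdf; rewrite oner_eq0.
have i2 : mu.-integrable setT (EFin \o (fun y => cos (a * y) * g y)).
  apply: (le_integrable measurableT _ _ i1) => //.
  - apply/measurable_EFinP; apply: continuous_measurable_fun => y.
    apply: cvgM; last exact: cg.
    apply: continuous_comp; last exact: continuous_cos.
    by apply: cvgM; [exact: cvg_cst|exact: cvg_id].
  - by move=> y _ /=; rewrite lee_fin normrM ler_piMl// cos_max.
under [RHS]eq_integral do rewrite /ckernel mulrBl mul1r EFinB.
rewrite integralB// integral_normal_pdf EFinB; congr (_ - _)%E.
have := gaussian_cos ltr01 a; rewrite /gkernel expr1n mul1r => <-.
by rewrite /Rintegral fineK// integrable_fin_num.
Qed.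

Let deficit_gE t y : ((1 - chf P W (t * y)) * g y)%:E = (\int[P]_w f t (w, y))%E.
Proof.
rewrite EFinM -integral_deficit// -ge0_integralZr//.
- apply: eq_integral => w _; rewrite /f/= -EFinM; congr (_ * _)%:E.
  by rewrite /ckernel mulrAC.
- by apply/measurable_EFinP; apply: measurable_funB => //; exact: measurable_cosM.
- by rewrite lee_fin normal_pdf_ge0.
Qed.

Lemma integral_gkernel t :
  (\int[P]_w (1 - gkernel (t * W w))%:E =
   \int[mu]_y ((1 - chf P W (t * y)) * g y)%:E)%E.
Proof.
transitivity (\int[P]_w \int[mu]_y f t (w, y))%E.
  by apply: eq_integral => w _; rewrite gkernelE.
rewrite (fubini_tonelli (f t) (mf t) (f0 t)).
by apply: eq_integral => y _; rewrite deficit_gE.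
Qed.

Lemma measurable_deficit_g t :
  measurable_fun setT (fun y : measurableTypeR R => ((1 - chf P W (t * y)) * g y)%:E).
Proof.
have -> : (fun y : measurableTypeR R => ((1 - chf P W (t * y)) * g y)%:E) =
    fubini_G P (f t) by apply/funext => y; rewrite deficit_gE.
exact: measurable_fun_fubini_tonelli_G.
Qed.

Lemma integral_gkernelE t : (\int[P]_w (gkernel (t * W w))%:E =
  1 - \int[P]_w (1 - gkernel (t * W w))%:E)%E.
Proof.
have gle1 x : gkernel x <= 1 :> R.
  by rewrite /gkernel -expR0 ler_expR oppr_le0 divr_ge0// sqr_ge0.
have mg : measurable_fun setT (fun w => gkernel (t * W w)).
  apply: (measurableT_comp (continuous_measurable_fun (@continuous_gkernel R))).
  exact: measurable_funM.
have ig : P.-integrable setT (EFin \o (fun w => gkernel (t * W w))).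
  apply: (@integrable_bounded _ _ _ _ _ 1) => // w.
  by rewrite ger0_norm ?gkernel_ge0.
have i1 : P.-integrable setT (EFin \o (fun _ => 1 : R)).
  exact: finite_measure_integrable_cst.
under [in RHS]eq_integral do rewrite EFinB.
rewrite integralB// integral_probability_cst1.
have : (\int[P]_w (gkernel (t * W w))%:E \is a fin_num)%E by exact: integrable_fin_num.
by case: (\int[P]_w (gkernel (t * W w))%:E)%E => // r _; rewrite -!EFinB; congr EFin; ring.
Qed.

End gaussian_average.

Section moment_comparison.
Context {R : realType} d1 d2 (T1 : measurableType d1) (T2 : measurableType d2).
Variables (P1 : probability T1 R) (P2 : probability T2 R) (V : T1 -> R) (W : T2 -> R).
Hypotheses (mV : measurable_fun setT V) (mW : measurable_fun setT W).
Hypothesis chf_le : forall t, chf P2 W t <= chf P1 V t.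
Local Notation mu := (@lebesgue_measure R).

Lemma le_abs_moment_pos (p : R) : 0 < p -> p <= 2 ->
  (abs_moment P1 V p <= abs_moment P2 W p)%E.
Proof.
move=> p0; rewrite le_eqVlt => /predU1P[->|p2].
  have := @moment2_le_deficit _ _ _ P1 V mV 1 ((1 / 2)%:E * abs_moment P2 W 2)%E.
  rewrite expr1n => H.
  rewrite -(@lee_pmul2l _ (1 / 2)%:E)// ?lte_fin ?divr_gt0//; apply: H => n.
  apply: (@le_trans _ _ (n.+1%:R ^+ 2 * (1 - chf P2 W (1 / n.+1%:R)))%:E).
    by rewrite lee_fin ler_wpM2l ?sqr_ge0// lerB.
  rewrite EFinM.
  have n2 : (0 <= (n.+1%:R ^+ 2)%:E :> \bar R)%E by rewrite lee_fin sqr_ge0.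
  apply: le_trans (lee_wpmul2l n2 (deficit_le_moment2 P2 mW _)) _.
  rewrite muleA -EFinM; apply: lee_wpmul2r.
    by apply: integral_ge0 => w _; rewrite /epow; case: ifP; rewrite ?poweR_ge0 ?ltNge ?ler0n.
  rewrite lee_fin le_eqVlt; apply/orP; left; apply/eqP; field.
  by rewrite nat1r pnatr_eq0.
apply: (le_abs_moment_mixture (K := ckernel)) => //.
- exact: continuous_ckernel.
- exact: one_minus_cos_ge0.
- by move=> x; rewrite /ckernel cosN.
- by apply: mellin_ckernel_lty; rewrite p0.
- by apply: mellin_gt0; [exact: continuous_ckernel|exact: one_minus_cos_ge0|exact: one_minus_cos_gt0].
- by rewrite mellin_ckernel0 /epow ltNge (ltW p0)/= powR0 ?mul0e// gt_eqF.
- move=> t; rewrite !integral_deficit// lee_fin.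
  by rewrite lerB.
Qed.

Lemma le_abs_moment_neg (p : R) : -1 < p -> p < 0 ->
  (abs_moment P2 W p <= abs_moment P1 V p)%E.
Proof.
move=> p1 p0.
have K0 := @gkernel_ge0 R.
have Kgt0 : (0 < mellin (@gkernel R) p 1)%E.
  apply: mellin_gt0 => //; first exact: continuous_gkernel.
  by move=> x _; exact: expR_gt0.
apply: (le_abs_moment_mixture (K := gkernel)) => //.
- exact: continuous_gkernel.
- by move=> x; rewrite /gkernel sqrrN.
- by apply: mellin_gkernel_lty; rewrite p1.
- rewrite mellin_gkernel0// /epow p0 poweR_EFin powR0 ?oppr_eq0 ?lt_eqF//.
  by rewrite inver eqxx gt0_mulye.
- move=> t; rewrite !integral_gkernelE//; apply: leeB => //.
  rewrite !integral_gkernel//; apply: ge0_le_integral => //.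
  + by move=> y _; rewrite lee_fin mulr_ge0 ?normal_pdf_ge0// subr_ge0 chf_le1.
  + exact: measurable_deficit_g.
  + exact: measurable_deficit_g.
  + by move=> y _; rewrite lee_fin ler_wpM2r ?normal_pdf_ge0// lerB.
Qed.

End moment_comparison.

(** * Random variables with a density, Gaussian variables, variance *)

Section laws.
Context {R : realType} d (T : measurableType d) (P : probability T R).
Local Notation mu := (@lebesgue_measure R).

Lemma integral_density (X : T -> R) (phi f : R -> R) :
  measurable_fun setT X -> has_density P X phi -> measurable_fun setT f ->
  (forall x, 0 <= f x) ->
  (\int[P]_w (f (X w))%:E = \int[mu]_y (f y * phi y)%:E)%E.
Proof.
move=> mX [mphi phi0 Pphi] mf f0.
have := @eq_weighted_integral R _ _ _ _ P mu X (fun=> 1) (fun y => y) phi f mX _ _ _ mphi phi0 _ mf f0.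
move=> <-//.
  by apply: eq_integral => w _; rewrite mulr1.
move=> A mA; rewrite integral_cst.
  by rewrite mul1e; exact: Pphi.
exact: measurable_preimageT.
Qed.

Lemma integral_density1 (X : T -> R) (phi : R -> R) : has_density P X phi ->
  (\int[mu]_y (phi y)%:E = 1)%E.
Proof.
move=> [_ _ /(_ setT measurableT) <-]; rewrite preimage_setT; exact: probability_setT.
Qed.

Lemma Rintegral_density (X : T -> R) (phi f : R -> R) :
  measurable_fun setT X -> has_density P X phi -> measurable_fun setT f ->
  (forall x, `|f x| <= 1) ->
  \int[P]_w f (X w) = \int[mu]_y (f y * phi y).
Proof.
move=> mX dphi mf f1; have [mphi phi0 Pphi] := dphi.
rewrite -(@eq_weighted_Rintegral R _ _ _ _ P mu X (fun=> 1) (fun y => y) phi f)//.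
- by apply: eq_Rintegral => w _; rewrite mulr1.
- exact: finite_measure_integrable_cst.
- apply/integrableP; split; first exact/measurable_EFinP.
  under eq_integral do rewrite /= ger0_norm//.
  by rewrite (integral_density1 dphi) ltry.
- move=> A mA; rewrite integral_cst.
    by rewrite mul1e; exact: Pphi.
  exact: measurable_preimageT.
Qed.

Lemma chf_fourier (X : T -> R) (phi : R -> R) (x : R) :
  measurable_fun setT X -> has_density P X phi ->
  complex.Re (fourier phi x) = chf P X (2 * pi * x).
Proof.
move=> mX dphi.
rewrite /chf (@Rintegral_density X phi (fun y => cos (2 * pi * x * y)))//; last 2 first.
- exact: measurable_cosM.
- by move=> y; exact: cos_max.
rewrite /fourier /cintegral /=; apply: eq_Rintegral => y _.
by rewrite /= mul0r subr0 cosN mulrC.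
Qed.

Lemma gaussian_density (Z : T -> R) (s : R) :
  0 < s -> (forall A : set R, measurable A -> P (Z @^-1` A) = normal_prob 0 s A) ->
  has_density P Z (normal_pdf 0 s).
Proof.
by move=> s0 PZ; split => //; [exact: measurable_normal_pdf|exact: normal_pdf_ge0].
Qed.

Lemma chf_gaussian (Z : T -> R) (s t : R) : measurable_fun setT Z ->
  0 < s -> (forall A : set R, measurable A -> P (Z @^-1` A) = normal_prob 0 s A) ->
  chf P Z t = expR (- (s ^+ 2 * t ^+ 2 / 2)).
Proof.
move=> mZ s0 PZ; rewrite -gaussian_cos// /chf.
apply: (@Rintegral_density Z (normal_pdf 0 s) (fun y => cos (t * y))) => //.
- exact: gaussian_density.
- exact: measurable_cosM.
- by move=> y; exact: cos_max.
Qed.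

Lemma moment2_gaussian (Z : T -> R) (s : R) : measurable_fun setT Z ->
  0 < s -> (forall A : set R, measurable A -> P (Z @^-1` A) = normal_prob 0 s A) ->
  abs_moment P Z 2 = (s ^+ 2)%:E.
Proof.
move=> mZ s0 PZ; rewrite moment2E -(gaussian_moment2 s0).
apply: (@integral_density Z (normal_pdf 0 s) (fun y => y ^+ 2)) => //.
- exact: gaussian_density.
- by move=> x; exact: sqr_ge0.
Qed.

Let measurable_max0 (f : R -> R) : measurable_fun setT f ->
  measurable_fun setT (fun y => Num.max (f y) 0).
Proof. by move=> mf; apply: measurable_maxr. Qed.

Lemma expectation_density (X : T -> R) (phi : R -> R) :
  measurable_fun setT X -> has_density P X phi ->
  ('E_P[X] = \int[mu]_y (y * phi y)%:E)%E.
Proof.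
move=> mX dphi; have [mphi phi0 _] := dphi.
rewrite unlock integralE [RHS]integralE; congr (_ - _)%E.
  transitivity (\int[P]_w (Num.max (X w) 0)%:E)%E.
    by apply: eq_integral => w _; rewrite funeposE/= EFin_max.
  rewrite (@integral_density X phi (fun y => Num.max y 0))//.
  - by apply: eq_integral => y _; rewrite funeposE/= -EFin_max maxr_pMl ?mul0r.
  - exact: measurable_max0.
  - by move=> x; rewrite le_max lexx orbT.
transitivity (\int[P]_w (Num.max (- X w) 0)%:E)%E.
  by apply: eq_integral => w _; rewrite funenegE/= EFin_max.
rewrite (@integral_density X phi (fun y => Num.max (- y) 0))//.
- by apply: eq_integral => y _; rewrite funenegE/= -EFin_max maxr_pMl ?mul0r ?mulNr.
- exact: measurable_max0.
- by move=> x; rewrite le_max lexx orbT.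
Qed.

Lemma expectation_gaussian (Z : T -> R) (s : R) : measurable_fun setT Z ->
  0 < s -> (forall A : set R, measurable A -> P (Z @^-1` A) = normal_prob 0 s A) ->
  fine ('E_P[Z])%E = 0.
Proof.
move=> mZ s0 PZ; rewrite (expectation_density mZ (gaussian_density s0 PZ)).
exact: gaussian_mean.
Qed.

(** No integrability is needed: the positive and negative parts of X have the
    same integral, and when it is infinite the expectation is
    +oo - +oo = -oo, which [fine] maps to 0. *)
Lemma fine_expectation_sym (X : T -> R) : measurable_fun setT X ->
  symmetric_rv P X -> fine ('E_P[X])%E = 0.
Proof.
move=> mX symX; rewrite unlock integralE.
have -> : (\int[P]_w (EFin \o X)^\- w = \int[P]_w (EFin \o X)^\+ w)%E.
  transitivity (\int[P]_w (Num.max (- X w) 0 * 1)%:E)%E.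
    by apply: eq_integral => w _; rewrite funenegE/= mulr1 EFin_max.
  transitivity (\int[P]_w (Num.max (X w) 0 * 1)%:E)%E; last first.
    by apply: eq_integral => w _; rewrite funeposE/= mulr1 EFin_max.
  apply: (@eq_weighted_integral R _ _ _ _ P P (fun w => - X w) (fun=> 1) X (fun=> 1)
    (fun y => Num.max y 0)) => //.
  - exact: measurableT_comp.
  - move=> A mA; rewrite !integral_cst.
    + by rewrite !mul1e; apply/esym/symX.
    + exact: measurable_preimageT.
    + by apply: measurable_preimageT => //; exact: measurableT_comp.
  - exact: measurable_max0.
  - by move=> y; rewrite le_max lexx orbT.
by case: (\int[P]_w _)%E => [r| |]//=; rewrite subrr.
Qed.

Lemma variance_centered (X : T -> R) : fine ('E_P[X])%E = 0 ->
  ('V_P[X] = abs_moment P X 2)%E.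
Proof.
move=> EX; rewrite moment2E.
rewrite /variance unlock EX unlock.
by apply: eq_integral => w _; rewrite /= !fctE /= subr0.
Qed.

End laws.

(** * Log-concavity and log-convexity in the squared variable *)

Section chf_continuity.
Context {R : realType} d (T : measurableType d) (P : probability T R) (X : T -> R).
Hypothesis mX : measurable_fun setT X.

Lemma chf0 : chf P X 0 = 1.
Proof.
rewrite /chf; under eq_Rintegral do rewrite mul0r cos0.
by rewrite Rintegral_cst// mul1r [X in fine X](_ : _ = 1%E)//; exact: probability_setT.
Qed.

Lemma chfN t : chf P X (- t) = chf P X t.
Proof. by apply: eq_Rintegral => w _; rewrite mulNr cosN. Qed.

Lemma chf_norm t : chf P X `|t| = chf P X t.
Proof. by case: (ger0P t) => // _; rewrite chfN. Qed.

Lemma continuous_chf : continuous (chf P X).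
Proof.
move=> t.
have I : t \in `]t - 1, t + 1[%classic by rewrite inE/= in_itv/=; apply/andP; split; lra.
have mc a : measurable_fun setT (fun w => cos (a * X w)) by exact: measurable_cosM.
apply: (@continuity_under_integral R _ T P (fun a w => cos (a * X w)) setT measurableT
   (t - 1) (t + 1) _ _ (fun=> 1) _ _ t I).
- move=> a _; apply: (@integrable_bounded _ _ _ _ _ 1) => // w; exact: cos_max.
- apply: aeW => w _ a _; apply: continuous_comp; last exact: continuous_cos.
  by apply: cvgM; [exact: cvg_id|exact: cvg_cst].
- exact: finite_measure_integrable_cst.
- by move=> a _; apply: aeW => w _; exact: cos_max.
Qed.

End chf_continuity.

Section powR_facts.
Context {R : realType}.

(** For nonnegative exponents no condition on a is needed, as 0 `^ 0 = 1. *)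
Lemma ge0_powRD (a r s : R) : 0 <= r -> 0 <= s -> a `^ (r + s) = a `^ r * a `^ s.
Proof.
move=> r0 s0; have [->|a0] := eqVneq a 0; last by rewrite powRD// a0 implybT.
have [->|rn0] := eqVneq r 0; first by rewrite add0r powRr0 mul1r.
have rs0 : r + s != 0 by rewrite gt_eqF// ltr_pwDl// lt0r rn0.
by rewrite (powR0 rs0) (powR0 rn0) mul0r.
Qed.

Lemma powR_sum (I : Type) (r : seq I) (a : R) (e : I -> R) :
  (forall i, 0 <= e i) ->
  \prod_(i <- r) a `^ (e i) = a `^ (\sum_(i <- r) e i).
Proof.
move=> e0; elim: r => [|i r IH]; first by rewrite !big_nil powRr0.
by rewrite !big_cons IH ge0_powRD// sumr_ge0.
Qed.

Lemma cvg_powR1 (u : R^nat) (r : R) : u n @[n --> \oo] --> (1 : R) ->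
  u n `^ r @[n --> \oo] --> (1 : R).
Proof.
move=> u1.
have cp : {for 1, continuous (fun x : R => x `^ r)}.
  apply/differentiable_continuous/derivable1_diffP.
  by apply: derivable_powR; rewrite in_itv/= ltr01.
have := cvg_comp _ _ u1 cp.
by rewrite powR1.
Qed.

End powR_facts.

Section log_concave.
Context {R : realType}.
Variable psi : R -> R.
Hypothesis psi0 : psi 0 = 1.
Hypothesis psi_ge0 : forall t, 0 <= psi t.
Hypothesis psi_norm : forall t, psi `|t| = psi t.
Hypothesis cpsi : continuous psi.
Variable k : R.
Hypothesis k0 : 0 < k.
Let g t := psi (k * Num.sqrt t).

Let g_cvg (x l : R) :
  g (l * x + (1 - l) * n.+1%:R^-1) @[n --> \oo] --> g (l * x).
Proof.
have -> : g (l * x) = g (l * x + (1 - l) * 0) by rewrite mulr0 addr0.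
have cg : continuous g.
  move=> t; apply: continuous_comp; last exact: cpsi.
  by apply: cvgM; [exact: cvg_cst|exact: sqrt_continuous].
have h : l * x + (1 - l) * n.+1%:R^-1 @[n --> \oo] --> l * x + (1 - l) * 0.
  by apply: cvgD; [exact: cvg_cst|apply: cvgMr; exact: cvg_harmonic].
exact: (cvg_comp _ _ h (cg _)).
Qed.

Let g1_cvg r : (g n.+1%:R^-1) `^ r @[n --> \oo] --> (1 : R).
Proof.
apply: cvg_powR1; have := @g_cvg 0 0.
rewrite mulr0 /g sqrtr0 mulr0 psi0.
by under eq_fun do rewrite add0r subr0 mul1r.
Qed.

Let gE t c : psi (c * t) = g (c ^+ 2 * (t / k) ^+ 2).
Proof.
rewrite /g sqrtrM ?sqr_ge0// !sqrtr_sqr -normrM -(gtr0_norm k0) -normrM psi_norm.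
by rewrite (gtr0_norm k0) mulrCA; congr (psi _); field; rewrite gt_eqF.
Qed.

Let gE1 t : psi t = g ((t / k) ^+ 2).
Proof. by rewrite -[t in LHS]mul1r gE expr1n mul1r. Qed.

Let psi_unit t c : c ^+ 2 = 1 -> psi (c * t) = psi t.
Proof.
move=> c1; rewrite -[LHS]psi_norm normrM.
have -> : `|c| = 1.
  by apply/eqP; rewrite -(@eqrXn2 _ 2)// ?expr1n ?real_normK ?num_real// c1.
by rewrite mul1r psi_norm.
Qed.

Let g_powR_cvg x l :
  g x `^ l * g n.+1%:R^-1 `^ (1 - l) @[n --> \oo] --> g x `^ l.
Proof. by rewrite -[X in _ --> X]mulr1; apply: cvgMr; exact: g1_cvg. Qed.

(** Log-concavity between (t / k)^2 and a point that tends to 0, where g is 1. *)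
Lemma log_concave_powR_le t c : log_concave_on `]0, +oo[%classic g ->
  c ^+ 2 <= 1 -> psi t `^ (c ^+ 2) <= psi (c * t).
Proof.
move=> lc; rewrite le_eqVlt => /orP[/eqP c1|c1].
  by rewrite c1 powRr1// psi_unit.
have [->|c0] := eqVneq c 0; first by rewrite expr0n/= powRr0 mul0r psi0.
have [->|t0] := eqVneq t 0; first by rewrite mulr0 psi0 powR1.
have x0 : 0 < (t / k) ^+ 2 by rewrite exprn_even_gt0//= mulf_neq0// invr_neq0// gt_eqF.
have l0 : 0 < c ^+ 2 by rewrite exprn_even_gt0.
rewrite gE gE1.
have cv1 := @g_cvg ((t / k) ^+ 2) (c ^+ 2).
have cv2 := @g_powR_cvg ((t / k) ^+ 2) (c ^+ 2).
apply: (ler_cvg_to cv2 cv1); apply: nearW => n.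
by apply: lc; rewrite /= ?in_itv/= ?andbT ?invr_gt0// l0.
Qed.

Lemma log_convex_powR_ge t c : log_convex_on `]0, +oo[%classic g ->
  c ^+ 2 <= 1 -> psi (c * t) <= psi t `^ (c ^+ 2).
Proof.
move=> lc; rewrite le_eqVlt => /orP[/eqP c1|c1].
  by rewrite c1 powRr1// psi_unit.
have [->|c0] := eqVneq c 0; first by rewrite expr0n/= powRr0 mul0r psi0.
have [->|t0] := eqVneq t 0; first by rewrite mulr0 psi0 powR1.
have x0 : 0 < (t / k) ^+ 2 by rewrite exprn_even_gt0//= mulf_neq0// invr_neq0// gt_eqF.
have l0 : 0 < c ^+ 2 by rewrite exprn_even_gt0.
rewrite gE gE1.
have cv1 := @g_cvg ((t / k) ^+ 2) (c ^+ 2).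
have cv2 := @g_powR_cvg ((t / k) ^+ 2) (c ^+ 2).
apply: (ler_cvg_to cv1 cv2); apply: nearW => n.
by apply: lc; rewrite /= ?in_itv/= ?andbT ?invr_gt0// l0.
Qed.

End log_concave.

(** * Comparison with the Gaussian characteristic function *)

Section gaussian_bounds.
Context {R : realType} d (T : measurableType d) (P : probability T R) (X : T -> R).
Hypothesis mX : measurable_fun setT X.
Variable v : R.
Hypothesis Xv : abs_moment P X 2 = v%:E.
Hypothesis chf_ge0 : forall t, 0 <= chf P X t.

Let invn_le1 n : (n.+1%:R^-1 : R) ^+ 2 <= 1.
Proof. by rewrite exprn_ile1// ?invr_ge0// invf_le1// ler1n. Qed.

Let lt_sqr_bound (x : R) : 0 <= x -> x < (Num.bound x).+1%:R ^+ 2.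
Proof.
move=> x0; apply: (lt_le_trans (archi_boundP x0)); rewrite -natrX ler_nat.
by rewrite (leq_trans (leqnSn _))// -{1}(expn1 (Num.bound x).+1) leq_pexp2l.
Qed.

(** With c = 1 / n, n^2 (1 - chf (t / n)) <= - ln (chf t) for every n, and the
    left-hand side tends to v * t^2 / 2. *)
Lemma chf_le_gaussian t :
  (forall c, c ^+ 2 <= 1 -> chf P X t `^ (c ^+ 2) <= chf P X (c * t)) ->
  chf P X t <= expR (- (v * t ^+ 2 / 2)).
Proof.
move=> Hc; have [->|psi0] := eqVneq (chf P X t) 0; first exact: expR_ge0.
have psi_gt0 : 0 < chf P X t by rewrite lt0r psi0 chf_ge0.
have H : ((t ^+ 2 / 2)%:E * abs_moment P X 2 <= (- ln (chf P X t))%:E)%E.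
  apply: moment2_le_deficit => // n; rewrite lee_fin.
  have := Hc n.+1%:R^-1 (invn_le1 n).
  rewrite [_^-1 * t]mulrC => Hn.
  have Hn0 : 0 < chf P X (t / n.+1%:R) by apply: lt_le_trans Hn; exact: powR_gt0.
  move: Hn; rewrite -ler_ln ?posrE ?powR_gt0// ln_powR => Hn.
  have L : ln (chf P X (t / n.+1%:R)) <= chf P X (t / n.+1%:R) - 1.
    have := @le_ln1Dx R (chf P X (t / n.+1%:R) - 1).
    by rewrite [1 + _]addrC subrK; apply; lra.
  have n0 : 0 < n.+1%:R :> R by [].
  have := le_trans Hn L.
  rewrite exprVn ler_pdivrMl ?exprn_gt0//; lra.
move: H; rewrite Xv -EFinM lee_fin => H.
rewrite -[leLHS]lnK ?posrE// ler_expR; lra.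
Qed.

(** With c = 1 / n and N = n^2, chf t >= (1 - v t^2 / (2 N))^N as soon as the base
    is positive, and N tends to infinity. *)
Lemma chf_ge_gaussian t :
  (forall c, c ^+ 2 <= 1 -> chf P X (c * t) <= chf P X t `^ (c ^+ 2)) ->
  expR (- (v * t ^+ 2 / 2)) <= chf P X t.
Proof.
move=> Hc.
have v0 : 0 <= v.
  by rewrite -lee_fin -Xv moment2E; apply: integral_ge0 => w _; rewrite lee_fin sqr_ge0.
pose c := v * t ^+ 2 / 2.
have c0 : 0 <= c by rewrite /c divr_ge0// mulr_ge0// sqr_ge0.
have low n : 1 - c / n.+1%:R ^+ 2 <= chf P X t `^ (n.+1%:R^-1 ^+ 2).
  apply: le_trans (Hc _ (invn_le1 n)).
  have := deficit_le_moment2 P mX (n.+1%:R^-1 * t).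
  rewrite Xv -EFinM lee_fin => H.
  suff -> : c / n.+1%:R ^+ 2 = (n.+1%:R^-1 * t) ^+ 2 / 2 * v.
    by rewrite lerBlDr -lerBlDl.
  by rewrite /c exprMn exprVn; ring.
have psi_gt0 : 0 < chf P X t.
  rewrite lt0r chf_ge0 andbT; apply/eqP => psi0.
  have := low (Num.bound c); rewrite psi0 powR0 ?expf_neq0 ?invr_neq0// => H.
  move: H; rewrite subr_le0 ler_pdivlMr ?exprn_gt0// mul1r.
  by rewrite leNgt lt_sqr_bound.
rewrite -[leRHS]lnK ?posrE// ler_expR -/c lerNl.
set L := - ln _; rewrite leNgt; apply/negP => cL.
have L0 : 0 < L by exact: le_lt_trans cL.
have key n : c < n.+1%:R ^+ 2 -> L * (1 - c / n.+1%:R ^+ 2) <= c.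
  move=> cn; have N0 : 0 < n.+1%:R ^+ 2 :> R by rewrite exprn_gt0.
  have y1 : 0 < 1 - c / n.+1%:R ^+ 2 by rewrite subr_gt0 ltr_pdivrMr// mul1r.
  have := low n; rewrite -ler_ln ?posrE ?powR_gt0// ln_powR exprVn => H1.
  set z := c / n.+1%:R ^+ 2 in y1 H1 *.
  have z0 : 0 <= z by rewrite /z divr_ge0// ltW.
  (* From ln (1 + y) <= y with 1 + y = (1 - z)^-1. *)
  have H2 : - ln (1 - z) <= z / (1 - z).
    rewrite -lnV ?posrE//.
    have E : (1 - z)^-1 = 1 + z / (1 - z) by field; rewrite gt_eqF.
    rewrite [X in ln X]E.
    apply: le_ln1Dx; apply: (@lt_le_trans _ _ 0) => //.
    by rewrite divr_ge0// ltW.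
  have H3 : (n.+1%:R ^+ 2)^-1 * L <= z / (1 - z).
    by rewrite /L mulrN; apply: le_trans H2; rewrite lerN2.
  move: H3; rewrite ler_pdivlMr// -mulrA ler_pdivrMl//.
  suff -> : n.+1%:R ^+ 2 * z = c by [].
  by rewrite /z mulrC divfK ?gt_eqF.
(* Any N beyond L c / (L - c) violates [key]. *)
pose B := (L * c) / (L - c) + c.
have Lc0 : 0 <= L * c / (L - c) by rewrite divr_ge0 ?subr_ge0 ?(ltW cL)// mulr_ge0// ltW.
have B0 : 0 <= B by rewrite addr_ge0.
have bB := lt_sqr_bound B0.
set N := (Num.bound B).+1%:R ^+ 2 in bB.
have N0 : 0 < N by rewrite /N exprn_gt0.
have cN : c < N.
  by apply: le_lt_trans bB; rewrite /B lerDr.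
have := key _ cN; rewrite -/N.
have LcN : L * c / (L - c) < N.
  by apply: le_lt_trans bB; rewrite /B lerDl.
move: LcN; rewrite ltr_pdivrMr ?subr_gt0// => LcN.
apply/negP; rewrite -ltNge.
rewrite -subr_gt0.
have -> : L * (1 - c / N) - c = (N * (L - c) - L * c) / N by field; rewrite gt_eqF.
by rewrite divr_gt0// subr_gt0.
Qed.

End gaussian_bounds.

Section pnorm_facts.
Context {R : realType}.

Lemma abs_moment_ge0 d (T : measurableType d) (P : probability T R) (W : T -> R) p :
  (0 <= abs_moment P W p)%E.
Proof.
apply: integral_ge0 => w _; rewrite /epow; case: ifP => _; last exact: poweR_ge0.
by rewrite inve_ge0 poweR_ge0.
Qed.

Lemma pnorm2E d (T : measurableType d) (P : probability T R) (W : T -> R) v :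
  abs_moment P W 2 = v%:E -> pnorm P W 2 = (v `^ 2^-1)%:E.
Proof. by move=> E; rewrite /pnorm E /epow ltNge invr_ge0 ler0n. Qed.

(** For p < 0 a larger characteristic function gives a larger moment, and the
    exponent 1 / p reverses the order once more. *)
Lemma le_pnorm_chf d1 d2 (T1 : measurableType d1) (T2 : measurableType d2)
    (P1 : probability T1 R) (P2 : probability T2 R) (V : T1 -> R) (W : T2 -> R) p :
  measurable_fun setT V -> measurable_fun setT W ->
  -1 < p -> p <= 2 -> p != 0 ->
  (forall t, chf P2 W t <= chf P1 V t) -> (pnorm P1 V p <= pnorm P2 W p)%E.
Proof.
move=> mV mW p1 p2 pn0 H; rewrite /pnorm /epow invr_lt0.
have [p0|p0|/eqP] := ltgtP p 0; last by rewrite (negbTE pn0).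
  rewrite lee_pV2 ?inE ?poweR_ge0//.
  apply: gt0_ler_poweR; rewrite ?in_itv/= ?leey ?abs_moment_ge0//.
    by rewrite oppr_ge0 invr_le0 ltW.
  exact: le_abs_moment_neg.
apply: gt0_ler_poweR; rewrite ?in_itv/= ?leey ?abs_moment_ge0//.
  by rewrite invr_ge0 ltW.
exact: le_abs_moment_pos.
Qed.

End pnorm_facts.

Theorem corollary3p7 (R : realType)
    (d : measure_display) (T : measurableType d) (P : probability T R)
    (n : nat) (X : 'I_n.+1 -> {RV P >-> R}) (phi : R -> R)
    (d' : measure_display) (T' : measurableType d') (Q : probability T' R)
    (Z : {RV Q >-> R}) (p : R)
    (X_iid : iid P (fun i => X i : T -> R))
    (X_sym : forall i, symmetric_rv P (X i))
    (X_density : forall i, has_density P (X i) phi)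
    (phi_hat_integrable : cintegrable (fourier phi))
    (phi_hat_ge0 : forall x : R, 0 <= fourier phi x)
    (p_gtN1 : -1 < p) (p_le2 : p <= 2) (p_neq0 : p != 0)
    (X_moment2 : (abs_moment P (X ord0) 2 < +oo)%E)
    (X_momentp : (abs_moment P (X ord0) p < +oo)%E)
    (Z_gaussian : centered_gaussian Q Z)
    (Z_variance : ('V_Q[Z] = 'V_P[X ord0])%E)
    (theta : 'rV[R]_n.+1) (theta_sphere : euclidean_sphere theta) :
  let S := fun w => \sum_(i < n.+1) theta ord0 i * X i w in
  let phi_hat_sqrt := fun t : R => complex.Re (fourier phi (Num.sqrt t)) in
  (log_concave_on `]0, +oo[ phi_hat_sqrt ->
    (pnorm Q Z p / pnorm P (X ord0) 2 * pnorm P S 2 <= pnorm P S p)%E /\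
    (pnorm P S p <= pnorm P (X ord0) p / pnorm P (X ord0) 2 * pnorm P S 2)%E)
  /\
  (log_convex_on `]0, +oo[ phi_hat_sqrt ->
    (pnorm Q Z p / pnorm P (X ord0) 2 * pnorm P S 2 >= pnorm P S p)%E /\
    (pnorm P S p >= pnorm P (X ord0) p / pnorm P (X ord0) 2 * pnorm P S 2)%E).
Proof.
move=> S phi_hat_sqrt.
have mX i : measurable_fun setT (X i : T -> R) by [].
have mZ : measurable_fun setT (Z : T' -> R) by [].
have mS : measurable_fun setT S.
  by apply: measurable_sum => i; exact: measurable_funM.
pose psi := chf P (X ord0 : T -> R).
have phiE x : complex.Re (fourier phi x) = psi (2 * pi * x).
  exact: (chf_fourier x (mX ord0) (X_density ord0)).
have pi2 : 0 < 2 * pi :> R by rewrite mulr_gt0// pi_gt0.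
have tE (t : R) : t = 2 * pi * (t / (2 * pi)).
  by apply/esym; rewrite mulrC; apply: divfK; exact: lt0r_neq0 pi2.
have chfX i t : chf P (X i : T -> R) t = psi t.
  by rewrite (tE t) -phiE (chf_fourier _ (mX i) (X_density i)).
have psi_ge0 t : 0 <= psi t.
  by rewrite (tE t) -phiE; have := phi_hat_ge0 (t / (2 * pi)); rewrite lecE => /andP[].
have chfS t : chf P S t = \prod_(i < n.+1) psi (theta ord0 i * t).
  under eq_bigr => i _ do rewrite -(chfX i).
  rewrite -(chf_sum_independent (P := P) (X := fun i => X i : T -> R)
    (fun i => theta ord0 i * t))//; last exact: X_iid.1.
  apply: eq_Rintegral => w _; rewrite mul1r /S mulr_sumr.
  by congr cos; apply: eq_bigr => i _; rewrite mulrA (mulrC t).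
have theta1 : \sum_(i < n.+1) theta ord0 i ^+ 2 = 1.
  have := theta_sphere; rewrite /euclidean_sphere /= => E.
  rewrite -[LHS]sqr_sqrtr ?E ?expr1n//.
  by apply: sumr_ge0 => i _; exact: sqr_ge0.
have theta_le1 i : theta ord0 i ^+ 2 <= 1.
  rewrite -theta1 (bigD1 i)//= lerDl.
  by apply: sumr_ge0 => j _; exact: sqr_ge0.
(* All the second moments are expressed through the standard deviation s of Z. *)
have [s s0 Zs] := Z_gaussian.
have Z2 := moment2_gaussian mZ s0 Zs.
have X2 : abs_moment P (X ord0) 2 = (s ^+ 2)%:E.
  rewrite -Z2 -(variance_centered (expectation_gaussian mZ s0 Zs)).
  by rewrite Z_variance variance_centered// fine_expectation_sym.
have chfZ t : chf Q Z t = expR (- (s ^+ 2 * t ^+ 2 / 2)) by exact: chf_gaussian.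
have prodZ t : \prod_(i < n.+1) expR (- (s ^+ 2 * (theta ord0 i * t) ^+ 2 / 2)) = chf Q Z t.
  rewrite chfZ -expR_sum; congr expR.
  transitivity (\sum_(i < n.+1) theta ord0 i ^+ 2 * - (s ^+ 2 * t ^+ 2 / 2)).
    by apply: eq_bigr => i _; rewrite exprMn; ring.
  by rewrite -mulr_suml theta1 mul1r.
have prodX t : \prod_(i < n.+1) psi t `^ (theta ord0 i ^+ 2) = psi t.
  by rewrite powR_sum ?theta1 ?powRr1// => i; exact: sqr_ge0.
have psi0 : psi 0 = 1 by exact: chf0.
have psi_norm t : psi `|t| = psi t by exact: chf_norm.
have cpsi : continuous psi by exact: continuous_chf.
have gE : phi_hat_sqrt = fun t => psi (2 * pi * Num.sqrt t).
  by apply/funext => t; rewrite /phi_hat_sqrt phiE.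
(* The 2-norms cancel for a variable with the same second moment as Z. *)
have normE d1 (T1 : measurableType d1) (P1 : probability T1 R) (W : T1 -> R) (a : \bar R) :
    abs_moment P1 W 2 = (s ^+ 2)%:E ->
    (a / pnorm P (X ord0) 2 * pnorm P1 W 2 = a)%E.
  move=> W2; rewrite (pnorm2E X2) (pnorm2E W2) -muleA.
  have sn0 : (s ^+ 2) `^ 2^-1 != 0 by rewrite gt_eqF// powR_gt0// exprn_gt0.
  by rewrite inver (negbTE sn0) -EFinM mulVf// mule1.
rewrite gE; split=> lc.
- have low t : psi t <= chf P S t.
    rewrite chfS -[leLHS]prodX; apply: ler_prod => i _; rewrite powR_ge0/=.
    exact: (log_concave_powR_le psi0 psi_ge0 psi_norm cpsi pi2 _ lc (theta_le1 i)).
  have up t : chf P S t <= chf Q Z t.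
    rewrite chfS -prodZ; apply: ler_prod => i _; rewrite psi_ge0/=.
    apply: (chf_le_gaussian (mX ord0) X2) => // c c1.
    exact: (log_concave_powR_le psi0 psi_ge0 psi_norm cpsi pi2 _ lc c1).
  have S2 : abs_moment P S 2 = (s ^+ 2)%:E.
    apply/eqP; rewrite eq_le; apply/andP; split.
      by rewrite -X2; exact: le_abs_moment_pos.
    by rewrite -Z2; exact: le_abs_moment_pos.
  by rewrite !(normE _ _ _ S _ S2); split; exact: le_pnorm_chf.
- have low t : chf P S t <= psi t.
    rewrite chfS -[leRHS]prodX; apply: ler_prod => i _; rewrite psi_ge0/=.
    exact: (log_convex_powR_ge psi0 psi_ge0 psi_norm cpsi pi2 _ lc (theta_le1 i)).
  have up t : chf Q Z t <= chf P S t.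
    rewrite chfS -prodZ; apply: ler_prod => i _; rewrite expR_ge0/=.
    apply: (chf_ge_gaussian (mX ord0) X2) => // c c1.
    exact: (log_convex_powR_ge psi0 psi_ge0 psi_norm cpsi pi2 _ lc c1).
  have S2 : abs_moment P S 2 = (s ^+ 2)%:E.
    apply/eqP; rewrite eq_le; apply/andP; split.
      by rewrite -Z2; exact: le_abs_moment_pos.
    by rewrite -X2; exact: le_abs_moment_pos.
  by rewrite !(normE _ _ _ S _ S2); split; exact: le_pnorm_chf.
Qed.
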